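(* Generalized quantum Capelli identity: as operators on the multiparameter quantum group $\mathrm{GL}_{p,u}(n)$, $$d(xu^{n-1})=\prod_{1\le i<j\le n}p_{ij}\;{\det}_p(T)\;\mathrm{rdet}_{p^{-1}}(\partial(x)),$$ where ${\det}_p(T)$ acts by left multiplication, $x$ is the spectral parameter, and $d(x)$, $\mathrm{rdet}_{p^{-1}}(\partial(x))$ are the operators on $\mathrm{GL}_{p,u}(n)$ defined in the context.
   Context: Parameters: $u$, $p_{ij}$, $q_{ij}$ ($1\le i<j\le n$) are complex numbers with $p_{ij}q_{ij}=u^2$ for $i<j$, $u^2\neq-1$; extend by $p_{ii}=q_{ii}=1$, $p_{ij}p_{ji}=q_{ij}q_{ji}=1$ for all $i,j$. Assume also $u^2\ne 1$ and $[n]_{u^2}!\neq 0$, where $[m]_v=1+v+\cdots+v^{m-1}$, $[m]_v!=[1]_v\cdots[m]_v$. Quantum group: $\mathrm{M}_{p,u}(n)$ is the unital associative $\mathbb C$-algebra generated by $t_{ij}$, $1\le i,j\le n$, with relations, for $i<j$, $k<l$ (first relation for all $i$, second for all $k$): $t_{ik}t_{il}=q_{kl}t_{il}t_{ik}$; $t_{ik}t_{jk}=p_{ij}t_{jk}t_{ik}$; $q_{kl}t_{il}t_{jk}=p_{ij}t_{jk}t_{il}$; $q_{kl}^{-1}t_{ik}t_{jl}-q_{ij}^{-1}t_{jl}t_{ik}=(1-u^{-2})t_{il}t_{jk}$. It is a bialgebra with $\Delta(t_{ij})=\sum_k t_{ik}\otimes t_{kj}$, $\varepsilon(t_{ij})=\delta_{ij}$.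 Put $T=(t_{ij})$. For $\sigma\in S_n$ put $(-p)_\sigma=(-1)^{l(\sigma)}\prod_{i<j,\ \sigma_i>\sigma_j}p_{\sigma_j\sigma_i}$ ($l(\sigma)$ the number of inversions), and similarly $(-q)_\sigma$ and $(-p^{-1})_\sigma$ with $p_{ij}$ replaced by $q_{ij}$, respectively $p_{ij}^{-1}$. The quantum determinant is ${\det}_q(T)=\sum_\sigma(-q)_\sigma t_{1,\sigma_1}\cdots t_{n,\sigma_n}=\sum_\sigma(-p)_\sigma t_{\sigma_1,1}\cdots t_{\sigma_n,n}$, the last expression also being denoted ${\det}_p(T)$. $\mathrm{GL}_{p,u}(n)$ is the localization $\mathrm{M}_{p,u}(n)[{\det}_q(T)^{-1}]$; it is a Hopf algebra whose antipode $S$ satisfies $TS(T)=S(T)T=I$, $S(T)=(S(t_{ij}))$. Dual algebra: let $R^{+}=u\sum_i e_{ii}\otimes e_{ii}+u^{-1}\sum_{i<j}p_{ij}e_{ii}\otimes e_{jj}+u^{-1}\sum_{i>j}q_{ji}e_{ii}\otimes e_{jj}+(u-u^{-1})\sum_{i<j}e_{ij}\otimes e_{ji}$, $R^-=u^{-1}\sum_i e_{ii}\otimes e_{ii}+u\sum_{i>j}p_{ji}^{-1}e_{ii}\otimes e_{jj}+u\sum_{i<j}q_{ij}^{-1}e_{ii}\otimes e_{jj}+(u^{-1}-u)\sum_{i>j}e_{ij}\otimes e_{ji}$. $U(R)=\mathrm{U}_{p,u}(\mathfrak{gl}_n)$ is the unital associative algebra generated by $l^+_{ij},l^-_{ji}$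 ($1\le i\le j\le n$; other entries of $L^\pm=(l_{ij}^\pm)$ are $0$) with relations $R^+L_1^\pm L_2^\pm=L_2^\pm L_1^\pm R^+$, $R^+L_1^+L_2^-=L_2^-L_1^+R^+$ ($L_1=L\otimes I$, $L_2=I\otimes L$). It is a Hopf algebra with $\Delta(l^\pm_{ij})=\sum_k l^\pm_{ik}\otimes l^\pm_{kj}$, $\varepsilon(L^\pm)=I$, $S(L^\pm)=(L^\pm)^{-1}$ (in particular the $l_{ii}^\pm$ are understood to be invertible). There is a unique Hopf pairing $(\ ,\ ):U(R)\times\mathrm{GL}_{p,u}(n)\to\mathbb C$ with $(L_1^\pm,T_2)=R^\pm$, i.e. $(l^\pm_{ij},t_{ab})$ is the coefficient of $e_{ij}\otimes e_{ab}$ in $R^\pm$, extended by $(ab,\varphi)=(a\otimes b,\Delta(\varphi))$, $(a,\varphi\psi)=(\Delta(a),\varphi\otimes\psi)$. $U(R)$ acts on $\mathrm{GL}_{p,u}(n)$ from the left by $a.\varphi=\sum\varphi_{(1)}(a,\varphi_{(2)})$ and from the right by $\varphi.a=\sum(a,\varphi_{(1)})\varphi_{(2)}$. For $a\in U(R)$, $a^\circ$ denotes the operator $\varphi\mapsto\varphi.a$ (so $(ab)^\circ=b^\circ a^\circ$). Put $L(\lambda)=\lambda L^+-\lambda^{-1}L^-$ with entries $L_{ij}(\lambda)$. Operators: the matrix $\partial(\lambda)=(\partial_{ij}(\lambda))$ of linear operators on $\mathrm{GL}_{p,u}(n)$ is defined by $(u-u^{-1})\,\partial(\lambda)^t\varphi=(L(\lambda).\varphi)S(T)$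 for all $\varphi$, i.e. $(u-u^{-1})\partial_{ji}(\lambda)\varphi=\sum_k (L_{ik}(\lambda).\varphi)S(t_{kj})$. Further $$\mathrm{rdet}_{p^{-1}}(\partial(x))=\sum_{\sigma\in S_n}(-p^{-1})_\sigma\,\partial_{1\sigma_1}(x)\cdots\partial_{n\sigma_n}(x),$$ $$c(x)=\sum_{\sigma,\tau\in S_n}(-p)_\sigma(-q)_\tau L_{\sigma_n\tau_n}(xu^{1-n})L_{\sigma_{n-1}\tau_{n-1}}(xu^{2-n})\cdots L_{\sigma_1\tau_1}(x)\in U(R),$$ so that $c(x)^\circ=\sum_{\sigma,\tau}(-p)_\sigma(-q)_\tau L_{\sigma_1\tau_1}(x)^\circ L_{\sigma_2\tau_2}(xu^{-1})^\circ\cdots L_{\sigma_n\tau_n}(xu^{1-n})^\circ$, and $d(x)=(u-u^{-1})^{-n}([n]_{u^2}!)^{-1}c(x)^\circ$. *)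

(* Defs.v *)
From HB Require Import structures.
From mathcomp Require Import all_boot all_order all_algebra.
From mathcomp Require Import fingroup perm generic_quotient.
From mathcomp Require Import boolp finmap.
From mathcomp.real_closed Require Import mxtens.
From mathcomp.multinomials Require Import monalg.

Set Implicit Arguments.
Unset Strict Implicit.
Unset Printing Implicit Defensive.

Import GRing.Theory.

Local Open Scope ring_scope.
Local Open Scope quotient_scope.

Section FreeAlgebra.
Variables (K : fieldType) (G : choiceType).

Definition free_alg : Type := {malg K[{fmonom G}]}.

HB.instance Definition _ := GRing.Lalgebra.on free_alg.

Definition free_gen (g : G) : free_alg := << fmu g >>.

Lemma free_alg_scaleAr (c : K) (x y : free_alg) : c *: (x * y) = x * (c *: y).
Proof.
have ZU (a : K) m : c *: << a *g m >> = << c * a *g m >> :> {malg K[{fmonom G}]}.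
  by apply/malgP => k; rewrite mcoeffZ !mcoeffU mulrnAr.
rewrite -[x * y]/((x : {malg K[{fmonom G}]}) * y) malgM_def fgmull scaler_sumr.
rewrite -[RHS]/((x : {malg K[{fmonom G}]}) * (c *: y)) malgM_def.
rewrite (fgmullw (fsubset_refl _) (msuppZ_le c y)).
apply: eq_bigr => k1 _; rewrite scaler_sumr; apply: eq_bigr => k2 _.
by rewrite ZU mcoeffZ mulrCA.
Qed.

HB.instance Definition _ :=
  GRing.Lalgebra_isAlgebra.Build K free_alg free_alg_scaleAr.

Section Eval.
Variable v : G -> K.

Definition mon_eval (m : {fmonom G}) : K := \prod_(g <- (m : seq G)) v g.

Lemma mon_eval_mmorphism : mmorphism mon_eval.
Proof.
split=> [m1 m2|]; last by rewrite /mon_eval fm1 big_nil.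
by rewrite /mon_eval fmM big_cat.
Qed.

HB.instance Definition _ :=
  isMultiplicative.Build {fmonom G} K mon_eval mon_eval_mmorphism.

Definition free_eval : free_alg -> K := mmap idfun mon_eval.

Lemma free_eval_gen g : free_eval (free_gen g) = v g.
Proof. by rewrite /free_eval mmapU mul1r /mon_eval fmU big_seq1. Qed.

Lemma free_eval_linear : scalar free_eval.
Proof. by move=> c x y; rewrite /free_eval mmapD mmapZ. Qed.

Lemma free_eval_monoid : monoid_morphism free_eval.
Proof.
have [h1 h2] := mmap_is_multiplicative (f := idfun) (h := mon_eval).
by split.
Qed.

HB.instance Definition _ := GRing.isLinear.Build K free_alg K *%R free_eval
  free_eval_linear.
HB.instance Definition _ := GRing.isMonoidMorphism.Build free_alg K free_eval
  free_eval_monoid.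

End Eval.
End FreeAlgebra.

Section QuotientAlgebra.
Variables (K : fieldType) (A : algType K).

Inductive two_sided_ideal (S : A -> Prop) : A -> Prop :=
| Ideal_gen x of S x : two_sided_ideal S x
| Ideal_0 : two_sided_ideal S 0
| Ideal_D x y of two_sided_ideal S x & two_sided_ideal S y :
    two_sided_ideal S (x + y)
| Ideal_Ml a x of two_sided_ideal S x : two_sided_ideal S (a * x)
| Ideal_Mr a x of two_sided_ideal S x : two_sided_ideal S (x * a).

Variables (S : A -> Prop) (proper : ~ two_sided_ideal S 1).

Lemma idealZ c x : two_sided_ideal S x -> two_sided_ideal S (c *: x).
Proof. by rewrite -mulr_algl; exact: Ideal_Ml. Qed.

Lemma idealN x : two_sided_ideal S x -> two_sided_ideal S (- x).
Proof. by rewrite -mulN1r; exact: Ideal_Ml. Qed.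

Definition ideal_eq (x y : A) : bool := `[< two_sided_ideal S (x - y) >].

Lemma ideal_eq_refl : reflexive ideal_eq.
Proof. by move=> x; apply/asboolP; rewrite subrr; exact: Ideal_0. Qed.

Lemma ideal_eq_sym : symmetric ideal_eq.
Proof.
by move=> x y; apply/asboolP/asboolP => /idealN; rewrite opprB.
Qed.

Lemma ideal_eq_trans : transitive ideal_eq.
Proof.
move=> y x z /asboolP xy /asboolP yz; apply/asboolP.
by rewrite -(subrK y x) -addrA; exact: Ideal_D.
Qed.

Definition ideal_equiv :=
  EquivRel ideal_eq ideal_eq_refl ideal_eq_sym ideal_eq_trans.

(* Properness of the ideal is an argument because algType structures are
   nontrivial rings. *)
Definition quot_alg of ~ two_sided_ideal S 1 := {eq_quot ideal_equiv}.
Local Notation Q := (quot_alg proper).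

HB.instance Definition _ := Choice.on Q.
HB.instance Definition _ := EqQuotient.on Q.

Lemma quot_eqP (x y : A) :
  \pi_Q x = \pi_Q y <-> two_sided_ideal S (x - y).
Proof.
by split=> [/eqP|?]; [rewrite piE => /asboolP|apply/eqP; rewrite piE; apply/asboolP].
Qed.

Let op0 : Q := \pi_Q 0.
Let op1 : Q := \pi_Q 1.
Let opN (x : Q) : Q := \pi_Q (- repr x).
Let opD (x y : Q) : Q := \pi_Q (repr x + repr y).
Let opM (x y : Q) : Q := \pi_Q (repr x * repr y).
Let opZ (c : K) (x : Q) : Q := \pi_Q (c *: repr x).

Let repr_mod (x : A) : two_sided_ideal S (repr (\pi_Q x) - x).
Proof. by apply/quot_eqP; rewrite reprK. Qed.

Let piN x : \pi_Q (- x) = opN (\pi_Q x).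
Proof.
apply/quot_eqP; rewrite opprK addrC; exact: repr_mod.
Qed.

Let piD x y : \pi_Q (x + y) = opD (\pi_Q x) (\pi_Q y).
Proof.
apply/esym/quot_eqP; rewrite opprD addrACA; apply: Ideal_D; exact: repr_mod.
Qed.

Let piM x y : \pi_Q (x * y) = opM (\pi_Q x) (\pi_Q y).
Proof.
apply/esym/quot_eqP; set x' := repr _; set y' := repr _.
rewrite -(subrK (x' * y) (x' * y')) -addrA -mulrBr -mulrBl.
by apply: Ideal_D; [exact/Ideal_Ml/repr_mod|exact/Ideal_Mr/repr_mod].
Qed.

Let piZ c x : \pi_Q (c *: x) = opZ c (\pi_Q x).
Proof. by apply/esym/quot_eqP; rewrite -scalerBr; apply/idealZ/repr_mod. Qed.

Let piW (P : Q -> Prop) : (forall x, P (\pi_Q x)) -> forall x, P x.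
Proof. by move=> h x; rewrite -[x]reprK. Qed.

Let opDA : associative opD.
Proof.
by apply: piW => x; apply: piW => y; apply: piW => z; rewrite -!piD addrA.
Qed.

Let opDC : commutative opD.
Proof. by apply: piW => x; apply: piW => y; rewrite -!piD addrC. Qed.

Let op0D : left_id op0 opD.
Proof. by apply: piW => x; rewrite -piD add0r. Qed.

Let opND : left_inverse op0 opN opD.
Proof. by apply: piW => x; rewrite -piN -piD addNr. Qed.

HB.instance Definition _ := GRing.isZmodule.Build Q opDA opDC op0D opND.

Let opMA : associative opM.
Proof.
by apply: piW => x; apply: piW => y; apply: piW => z; rewrite -!piM mulrA.
Qed.

Let op1M : left_id op1 opM.
Proof. by apply: piW => x; rewrite -piM mul1r. Qed.

Let opM1 : right_id op1 opM.
Proof. by apply: piW => x; rewrite -piM mulr1. Qed.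

Let opMDl : left_distributive opM +%R.
Proof.
apply: piW => x; apply: piW => y; apply: piW => z.
by rewrite -[RHS]/(opD _ _) -[_ + _]/(opD _ _) -!(piM, piD) mulrDl.
Qed.

Let opMDr : right_distributive opM +%R.
Proof.
apply: piW => x; apply: piW => y; apply: piW => z.
by rewrite -[RHS]/(opD _ _) -[_ + _]/(opD _ _) -!(piM, piD) mulrDr.
Qed.

Let op1_neq0 : op1 != 0.
Proof.
by apply/eqP => /quot_eqP; rewrite subr0.
Qed.

HB.instance Definition _ := GRing.Zmodule_isNzRing.Build Q
  opMA op1M opM1 opMDl opMDr op1_neq0.

Let opZA a b v : opZ a (opZ b v) = opZ (a * b) v.
Proof. by move: v; apply: piW => v; rewrite -!piZ scalerA. Qed.

Let op1Z : left_id 1 opZ.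
Proof. by apply: piW => v; rewrite -piZ scale1r. Qed.

Let opZDr : right_distributive opZ +%R.
Proof.
move=> c; apply: piW => x; apply: piW => y.
by rewrite -[RHS]/(opD _ _) -[_ + _]/(opD _ _) -!(piZ, piD) scalerDr.
Qed.

Let opZDl v : {morph opZ^~ v : a b / a + b}.
Proof.
move: v; apply: piW => v a b.
by rewrite -[RHS]/(opD _ _) -!(piZ, piD) scalerDl.
Qed.

HB.instance Definition _ := GRing.Zmodule_isLmodule.Build K Q
  opZA op1Z opZDr opZDl.

Let opZAl a (x y : Q) : a *: (x * y) = a *: x * y.
Proof.
move: x y; apply: piW => x; apply: piW => y.
rewrite -[LHS]/(opZ _ (opM _ _)) -[RHS]/(opM (opZ _ _) _).
by rewrite -!(piZ, piM) scalerAl.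
Qed.

HB.instance Definition _ := GRing.Lmodule_isLalgebra.Build K Q opZAl.

Let opZAr a (x y : Q) : a *: (x * y) = x * (a *: y).
Proof.
move: x y; apply: piW => x; apply: piW => y.
rewrite -[LHS]/(opZ _ (opM _ _)) -[RHS]/(opM _ (opZ _ _)).
by rewrite -!(piZ, piM) scalerAr.
Qed.

HB.instance Definition _ := GRing.Lalgebra_isAlgebra.Build K Q opZAr.

Definition quot_proj (x : A) : Q := \pi_Q x.

Lemma quot_proj_linear : linear quot_proj.
Proof. by move=> c x y; rewrite /quot_proj piD piZ. Qed.

Lemma quot_proj_monoid : monoid_morphism quot_proj.
Proof. by split=> // x y; rewrite /quot_proj piM. Qed.

HB.instance Definition _ := GRing.isLinear.Build K A Q *:%R quot_proj
  quot_proj_linear.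
HB.instance Definition _ := GRing.isMonoidMorphism.Build A Q quot_proj
  quot_proj_monoid.

Lemma quot_proj_eq0 (x : A) : quot_proj x = 0 <-> two_sided_ideal S x.
Proof. by rewrite -[x in two_sided_ideal S x]subr0; exact: quot_eqP. Qed.

End QuotientAlgebra.

(* U ⊗ V: formal sums of pairs, identified when every bilinear map takes the
   same value on them. *)
Section TensorProduct.
Variables (K : fieldType) (U V : lmodType K).

Definition bilin (W : lmodType K) (f : U -> V -> W) :=
  bilinear_for *:%R *:%R f.

Definition formal_sum (W : lmodType K) (f : U -> V -> W) (s : seq (U * V)) : W :=
  \sum_(x <- s) f x.1 x.2.

Definition tensor_eq (s t : seq (U * V)) : bool :=
  `[< forall (W : lmodType K) (f : U -> V -> W),
        bilin f -> formal_sum f s = formal_sum f t >].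

Lemma tensor_eq_refl : reflexive tensor_eq.
Proof. by move=> s; apply/asboolP. Qed.

Lemma tensor_eq_sym : symmetric tensor_eq.
Proof. by move=> s t; apply/asboolP/asboolP => h W f /h. Qed.

Lemma tensor_eq_trans : transitive tensor_eq.
Proof.
by move=> t s r /asboolP st /asboolP tr; apply/asboolP => W f bf; rewrite st ?tr.
Qed.

Definition tensor_equiv :=
  EquivRel tensor_eq tensor_eq_refl tensor_eq_sym tensor_eq_trans.

Definition tensor := {eq_quot tensor_equiv}.

HB.instance Definition _ := Choice.on tensor.
HB.instance Definition _ := EqQuotient.on tensor.

Definition pure_tensor (x : U) (y : V) : tensor := \pi_tensor [:: (x, y)].

(* The linear map x ⊗ y |-> f x y; meaningful for bilinear f only. *)
Definition tensor_lift (W : lmodType K) (f : U -> V -> W) (t : tensor) : W :=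
  formal_sum f (repr t).

Lemma tensor_lift_pi (W : lmodType K) (f : U -> V -> W) s :
  bilin f -> tensor_lift f (\pi_tensor s) = formal_sum f s.
Proof.
move=> bf; rewrite /tensor_lift.
have /eqP : \pi_tensor (repr (\pi_tensor s)) = \pi_tensor s by rewrite reprK.
by rewrite piE => /asboolP ->.
Qed.

Lemma tensor_lift_pure (W : lmodType K) (f : U -> V -> W) x y :
  bilin f -> tensor_lift f (pure_tensor x y) = f x y.
Proof. by move=> bf; rewrite tensor_lift_pi// /formal_sum big_seq1. Qed.

Lemma tensor_ext (s t : tensor) :
  (forall (W : lmodType K) (f : U -> V -> W),
     bilin f -> tensor_lift f s = tensor_lift f t) -> s = t.
Proof.
move=> h; rewrite -[s]reprK -[t]reprK; apply/eqP; rewrite piE.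
by apply/asboolP => W f /h.
Qed.

Let op0 : tensor := \pi_tensor [::].
Let opD (s t : tensor) : tensor := \pi_tensor (repr s ++ repr t).
Let opZ (c : K) (s : tensor) : tensor :=
  \pi_tensor [seq (c *: x.1, x.2) | x <- repr s].
Let opN := opZ (-1).

Section Lift.
Variables (W : lmodType K) (f : U -> V -> W).
Hypothesis bf : bilin f.

Let lift0 : tensor_lift f op0 = 0.
Proof. by rewrite tensor_lift_pi// /formal_sum big_nil. Qed.

Let liftD s t : tensor_lift f (opD s t) = tensor_lift f s + tensor_lift f t.
Proof. by rewrite tensor_lift_pi// /formal_sum big_cat. Qed.

Let liftZ c s : tensor_lift f (opZ c s) = c *: tensor_lift f s.
Proof.
rewrite tensor_lift_pi// /tensor_lift /formal_sum big_map scaler_sumr.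
by apply: eq_bigr => x _ /=; rewrite (scalable_linear (bf.1 x.2)).
Qed.

Definition tensor_lift_ops := (lift0, liftD, liftZ).
End Lift.

Let opDA : associative opD.
Proof.
by move=> r s t; apply: tensor_ext => W f bf; rewrite !tensor_lift_ops// addrA.
Qed.

Let opDC : commutative opD.
Proof.
by move=> s t; apply: tensor_ext => W f bf; rewrite !tensor_lift_ops// addrC.
Qed.

Let op0D : left_id op0 opD.
Proof.
by move=> s; apply: tensor_ext => W f bf; rewrite !tensor_lift_ops// add0r.
Qed.

Let opND : left_inverse op0 opN opD.
Proof.
move=> s; apply: tensor_ext => W f bf.
by rewrite !tensor_lift_ops// scaleN1r addNr.
Qed.

HB.instance Definition _ := GRing.isZmodule.Build tensor opDA opDC op0D opND.

Let opZA a b s : opZ a (opZ b s) = opZ (a * b) s.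
Proof. by apply: tensor_ext => W f bf; rewrite !tensor_lift_ops// scalerA. Qed.

Let op1Z : left_id 1 opZ.
Proof.
by move=> s; apply: tensor_ext => W f bf; rewrite !tensor_lift_ops// scale1r.
Qed.

Let opZDr : right_distributive opZ +%R.
Proof.
move=> c s t; apply: tensor_ext => W f bf.
by rewrite !tensor_lift_ops// scalerDr.
Qed.

Let opZDl s : {morph opZ^~ s : a b / a + b}.
Proof.
move=> a b; apply: tensor_ext => W f bf.
by rewrite !tensor_lift_ops// scalerDl.
Qed.

HB.instance Definition _ := GRing.Zmodule_isLmodule.Build K tensor
  opZA op1Z opZDr opZDl.

Lemma tensor_lift_linear (W : lmodType K) (f : U -> V -> W) :
  bilin f -> linear (tensor_lift f).
Proof. by move=> bf c s t; rewrite !tensor_lift_ops. Qed.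

Lemma tensor_lift0 (W : lmodType K) (f : U -> V -> W) :
  bilin f -> tensor_lift f 0 = 0.
Proof. by move=> bf; rewrite tensor_lift_ops. Qed.

Lemma tensor_liftD (W : lmodType K) (f : U -> V -> W) s t :
  bilin f -> tensor_lift f (s + t) = tensor_lift f s + tensor_lift f t.
Proof. by move=> bf; rewrite tensor_lift_ops. Qed.

Lemma pure_bilin : bilin pure_tensor.
Proof.
split=> [y c x x'|x c y y']; apply: tensor_ext => W f bf.
  by rewrite tensor_lift_linear// !tensor_lift_pure// bf.1.
by rewrite tensor_lift_linear// !tensor_lift_pure// bf.2.
Qed.

End TensorProduct.

Section TensorAlgebra.
Variables (K : fieldType) (A B : algType K).
Local Notation T := (tensor A B).

Let op1 : T := pure_tensor 1 1.
Let opM (s t : T) : T := \pi_T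
  [seq (x.1 * y.1, x.2 * y.2) | x <- repr s, y <- repr t].

Section Lift.
Variables (W : lmodType K) (f : A -> B -> W).
Hypothesis bf : bilin f.

Lemma mul_bilin a b : bilin (fun a' b' => f (a * a') (b * b')).
Proof.
split=> [y c x x'|x c y y'] /=; first by rewrite mulrDr -scalerAr bf.1.
by rewrite mulrDr -scalerAr bf.2.
Qed.

Lemma lift_mul_bilin (t : T) :
  bilin (fun a b => tensor_lift (fun a' b' => f (a * a') (b * b')) t).
Proof.
split=> [y c x x'|x c y y'] /=; rewrite /tensor_lift /formal_sum scaler_sumr
  -big_split; apply: eq_bigr => z _ /=; rewrite mulrDl -scalerAl.
  by rewrite bf.1.
by rewrite bf.2.
Qed.

Lemma tensor_liftM s t : tensor_lift f (opM s t) =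
  tensor_lift (fun a b => tensor_lift (fun a' b' => f (a * a') (b * b')) t) s.
Proof. by rewrite tensor_lift_pi// /formal_sum big_allpairs_dep. Qed.
End Lift.

Let opMA : associative opM.
Proof.
move=> r s t; apply: tensor_ext => W f bf.
rewrite tensor_liftM// tensor_liftM// tensor_liftM; last exact: lift_mul_bilin.
apply: eq_bigr => x _; rewrite tensor_liftM; last exact: mul_bilin.
by apply: eq_bigr => y _; apply: eq_bigr => z _; rewrite !mulrA.
Qed.

Let op1M : left_id op1 opM.
Proof.
move=> s; apply: tensor_ext => W f bf.
rewrite tensor_liftM// tensor_lift_pure; last exact: lift_mul_bilin.
by apply: eq_bigr => x _; rewrite !mul1r.
Qed.

Let opM1 : right_id op1 opM.
Proof.
move=> s; apply: tensor_ext => W f bf; rewrite tensor_liftM//.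
apply: eq_bigr => x _.
by rewrite tensor_lift_pure ?mulr1//; exact: mul_bilin.
Qed.

Let opMDl : left_distributive opM +%R.
Proof.
move=> r s t; apply: tensor_ext => W f bf.
rewrite [RHS]tensor_liftD// !tensor_liftM//; apply: tensor_liftD.
exact: lift_mul_bilin.
Qed.

Let opMDr : right_distributive opM +%R.
Proof.
move=> r s t; apply: tensor_ext => W f bf.
rewrite [RHS]tensor_liftD// !tensor_liftM// -big_split.
apply: eq_bigr => x _; apply: tensor_liftD; exact: mul_bilin.
Qed.

HB.instance Definition _ := GRing.Zmodule_isPzRing.Build T
  opMA op1M opM1 opMDl opMDr.

Lemma pureM a b a' b' : pure_tensor a b * pure_tensor a' b' = pure_tensor (a * a') (b * b') :> T.
Proof.
apply: tensor_ext => W f bf; rewrite -[_ * _]/(opM _ _) tensor_liftM//.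
rewrite tensor_lift_pure; last exact: lift_mul_bilin.
by rewrite !tensor_lift_pure//; exact: mul_bilin.
Qed.

End TensorAlgebra.

Section HopfAlgebra.
Variable K : fieldType.

Definition tensor_map (U V U' V' : lmodType K) (f : U -> U') (g : V -> V') :
    tensor U V -> tensor U' V' :=
  tensor_lift (fun x y => pure_tensor (f x) (g y)).

Definition tensor_assoc (U V W : lmodType K) :
    tensor (tensor U V) W -> tensor U (tensor V W) :=
  tensor_lift (fun t z =>
    tensor_lift (fun x y => pure_tensor x (pure_tensor y z)) t).

Record hopf_algebra (A : algType K) := HopfAlgebra {
  comul : A -> tensor A A;
  counit : A -> K;
  antipode : A -> A;
  comul_linear : linear comul;
  comul_monoid : monoid_morphism comul;
  counit_linear : scalar counit;
  counit_monoid : monoid_morphism counit;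
  antipode_linear : linear antipode;
  comulA : forall a,
    tensor_assoc (tensor_map comul id (comul a)) = tensor_map id comul (comul a);
  counitl : forall a, tensor_lift (fun x y => counit x *: y) (comul a) = a;
  counitr : forall a, tensor_lift (fun x y => counit y *: x) (comul a) = a;
  antipodel : forall a,
    tensor_lift (fun x y => antipode x * y) (comul a) = (counit a)%:A;
  antipoder : forall a,
    tensor_lift (fun x y => x * antipode y) (comul a) = (counit a)%:A
}.

Section Pairing.
Variables (U A : algType K) (HU : hopf_algebra U) (HA : hopf_algebra A).
Variable pr : U -> A -> K.

Record hopf_pairing : Prop := HopfPairing {
  pairing_bilin : bilin (pr : U -> A -> K^o);
  pairingMl : forall a b f,
    pr (a * b) f =
    tensor_lift (fun f1 f2 => pr a f1 * pr b f2 : K^o) (comul HA f);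
  pairingMr : forall a f g,
    pr a (f * g) =
    tensor_lift (fun a1 a2 => pr a1 f * pr a2 g : K^o) (comul HU a);
  pairing1l : forall f, pr 1 f = counit HA f;
  pairing1r : forall a, pr a 1 = counit HU a;
  pairing_antipode : forall a f, pr (antipode HU a) f = pr a (antipode HA f)
}.

(* lact a f is a.f and ract a f is f.a. *)
Definition lact (a : U) (f : A) : A :=
  tensor_lift (fun f1 f2 => pr a f2 *: f1) (comul HA f).

Definition ract (a : U) (f : A) : A :=
  tensor_lift (fun f1 f2 => pr a f1 *: f2) (comul HA f).

End Pairing.
End HopfAlgebra.

Section PermWeight.
Variables (K : fieldType) (n : nat).

Definition perm_length (s : 'S_n) : nat :=
  #|[set ij : 'I_n * 'I_n | (ij.1 < ij.2)%N && (s ij.2 < s ij.1)%N]|.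

(* The coefficient (-p)_s. *)
Definition perm_weight (p : 'M[K]_n) (s : 'S_n) : K :=
  (-1) ^+ perm_length s *
  \prod_(i < n) \prod_(j < n | (i < j)%N && (s j < s i)%N) p (s j) (s i).

End PermWeight.

Section QuantumMatrices.
Variables (K : fieldType) (n : nat) (u : K) (p q : 'M[K]_n).

Section Relations.
Variables (A : algType K) (t : 'M[A]_n).

Inductive qmatrix_rel : A -> Prop :=
| Qmatrix_row (i k l : 'I_n) of (k < l)%N :
    qmatrix_rel (t i k * t i l - q k l *: (t i l * t i k))
| Qmatrix_col (i j k : 'I_n) of (i < j)%N :
    qmatrix_rel (t i k * t j k - p i j *: (t j k * t i k))
| Qmatrix_anti (i j k l : 'I_n) of (i < j)%N & (k < l)%N :
    qmatrix_rel (q k l *: (t i l * t j k) - p i j *: (t j k * t i l))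
| Qmatrix_diag (i j k l : 'I_n) of (i < j)%N & (k < l)%N :
    qmatrix_rel ((q k l)^-1 *: (t i k * t j l) - (q i j)^-1 *: (t j l * t i k)
                 - (1 - u ^- 2) *: (t i l * t j k)).

Definition det_q : A :=
  \sum_(s : 'S_n) perm_weight q s *: \prod_(i < n) t i (s i).

Definition det_p : A :=
  \sum_(s : 'S_n) perm_weight p s *: \prod_(i < n) t (s i) i.

End Relations.

(* Generators t_ij and, as None, the inverse of the quantum determinant. *)
Definition GL_free : algType K := free_alg K (option ('I_n * 'I_n)).

Definition GL_free_t : 'M[GL_free]_n :=
  \matrix_(i, j) free_gen K (Some (i, j)).

Definition GL_free_detV : GL_free := free_gen K None.

Inductive GL_rel : GL_free -> Prop :=
| GL_qmatrix x of qmatrix_rel GL_free_t x : GL_rel x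
| GL_mulrV : GL_rel (det_q GL_free_t * GL_free_detV - 1)
| GL_mulVr : GL_rel (GL_free_detV * det_q GL_free_t - 1).

End QuantumMatrices.

Lemma free_eval_proper (K : fieldType) (G : choiceType) (v : G -> K)
    (S : free_alg K G -> Prop) :
  (forall x, S x -> free_eval v x = 0) -> ~ two_sided_ideal S 1.
Proof.
move=> h; have ker x : two_sided_ideal S x -> free_eval v x = 0.
  elim=> [{}x /h //| |{}x y _ ex _ ey|a {}x _ ex|a {}x _ ex].
  - exact: rmorph0.
  - by rewrite rmorphD /= ex ey addr0.
  - by rewrite rmorphM /= ex mulr0.
  - by rewrite rmorphM /= ex mul0r.
by move=> /ker /eqP; rewrite rmorph1 oner_eq0.
Qed.

Section ScalarPoint.
Variables (K : fieldType) (n : nat) (u : K) (p q : 'M[K]_n) (A : algType K).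
Variables (f : {rmorphism A -> K}) (t : 'M[A]_n).
Hypothesis fZ : forall c x, f (c *: x) = c * f x.
Hypothesis ft : forall i j, f (t i j) = (i == j)%:R.

Lemma det_q_point : f (det_q q t) = 1.
Proof.
rewrite rmorph_sum (bigD1 1%g) //= fZ rmorph_prod /=.
rewrite [X in _ * X]big1 => [|i _]; last by rewrite ft perm1 eqxx.
rewrite mulr1 /perm_weight (_ : perm_length _ = 0%N); last first.
  apply/eqP; rewrite cards_eq0; apply/eqP/setP => -[i j]; rewrite !inE !perm1 /=.
  by case: ltngtP.
rewrite expr0 mul1r big1 => [|i _]; last first.
  by rewrite big1 // => j; rewrite !perm1; case: ltngtP.
rewrite big1 ?addr0 // => s s1.
have [i si] : exists i, s i != i.
  apply/existsP; apply: contraNT s1 => /existsPn h; apply/eqP/permP => i.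
  by rewrite perm1; apply/eqP; rewrite -[_ == _]negbK.
rewrite fZ rmorph_prod [X in _ * X](bigD1 i) //= ft eq_sym (negbTE si).
by rewrite mul0r mulr0.
Qed.

Lemma qmatrix_rel_point x : qmatrix_rel u p q t x -> f x = 0.
Proof.
case=> [i k l kl|i j k ij|i j k l ij kl|i j k l ij kl].
- rewrite rmorphB fZ !rmorphM /= !ft.
  have [ik|] := eqVneq i k; last by rewrite !(mul0r, mulr0) subrr.
  have [il|] := eqVneq i l; last by rewrite !(mul0r, mulr0) subrr.
  by move: kl; rewrite -ik il ltnn.
- rewrite rmorphB fZ !rmorphM /= !ft.
  have [ik|] := eqVneq i k; last by rewrite !(mul0r, mulr0) subrr.
  have [jk|] := eqVneq j k; last by rewrite !(mul0r, mulr0) subrr.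
  by move: ij; rewrite ik jk ltnn.
- rewrite rmorphB !fZ !rmorphM /= !ft.
  have [il|] := eqVneq i l; last by rewrite !(mul0r, mulr0) subrr.
  have [jk|] := eqVneq j k; last by rewrite !(mul0r, mulr0) subrr.
  by move: ij; rewrite il jk ltnNge (ltnW kl).
rewrite !rmorphB /= !fZ !rmorphM /= !ft.
have -> : (i == l)%:R * (j == k)%:R = 0 :> K.
  have [il|] := eqVneq i l; last by rewrite mul0r.
  have [jk|] := eqVneq j k; last by rewrite mulr0.
  by move: ij; rewrite il jk ltnNge (ltnW kl).
rewrite mulr0 subr0.
have [->|] := eqVneq i k; last by rewrite !(mul0r, mulr0) subrr.
have [->|] := eqVneq j l; last by rewrite !(mul0r, mulr0) subrr.
by rewrite subrr.
Qed.

End ScalarPoint.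

Section GL.
Variables (K : fieldType) (n : nat) (u : K) (p q : 'M[K]_n).

Let v (g : option ('I_n * 'I_n)) : K :=
  if g is Some (i, j) then (i == j)%:R else 1.

Let ev_t i j : free_eval v (GL_free_t K n i j) = (i == j)%:R.
Proof. by rewrite mxE free_eval_gen. Qed.

Let evZ c x : free_eval v (c *: x) = c * free_eval v x.
Proof. exact: (scalable_linear (free_eval_linear v)). Qed.

Lemma GL_proper : ~ two_sided_ideal (GL_rel u p q) 1.
Proof.
have ev_det := det_q_point q evZ ev_t.
apply: (free_eval_proper (v := v)) => x [{}x /(qmatrix_rel_point evZ ev_t)//| | ].
- by rewrite rmorphB rmorphM /= ev_det free_eval_gen rmorph1 mulr1 subrr.
- by rewrite rmorphB rmorphM /= ev_det free_eval_gen rmorph1 mulr1 subrr.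
Qed.

Definition GL_alg : algType K := quot_alg GL_proper.

Definition GL_t : 'M[GL_alg]_n :=
  map_mx (quot_proj GL_proper) (GL_free_t K n).

End GL.

Section RMatrices.
Variables (K : fieldType) (n : nat) (u : K) (p q : 'M[K]_n).

Local Notation e i j := (delta_mx i j : 'M[K]_n).

Definition R_plus : 'M[K]_(n * n) :=
  u *: (\sum_(i < n) e i i *t e i i)
  + u^-1 *: (\sum_(i < n) \sum_(j < n | (i < j)%N) p i j *: (e i i *t e j j))
  + u^-1 *: (\sum_(i < n) \sum_(j < n | (j < i)%N) q j i *: (e i i *t e j j))
  + (u - u^-1) *: (\sum_(i < n) \sum_(j < n | (i < j)%N) e i j *t e j i).

Definition R_minus : 'M[K]_(n * n) :=
  u^-1 *: (\sum_(i < n) e i i *t e i i)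
  + u *: (\sum_(i < n) \sum_(j < n | (j < i)%N) (p j i)^-1 *: (e i i *t e j j))
  + u *: (\sum_(i < n) \sum_(j < n | (i < j)%N) (q i j)^-1 *: (e i i *t e j j))
  + (u^-1 - u) *: (\sum_(i < n) \sum_(j < n | (j < i)%N) e i j *t e j i).

(* The coefficient of e_ij ⊗ e_ab in M. *)
Definition tens_coef (M : 'M[K]_(n * n)) (i j a b : 'I_n) : K :=
  M (mxtens_index (i, a)) (mxtens_index (j, b)).

Section RLL.
Variable A : algType K.

Definition tens1 (L : 'M[A]_n) : 'M[A]_(n * n) := L *t 1%:M.
Definition tens2 (L : 'M[A]_n) : 'M[A]_(n * n) := 1%:M *t L.

Definition RLL (L L' : 'M[A]_n) : 'M[A]_(n * n) :=
  let R := map_mx (GRing.in_alg A) R_plus in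
  R *m tens1 L *m tens2 L' - tens2 L' *m tens1 L *m R.

Lemma RLL_point (f : {rmorphism A -> K}) (L L' : 'M[A]_n) a b :
  map_mx f L = 1%:M -> map_mx f L' = 1%:M -> f (RLL L L' a b) = 0.
Proof.
move=> fL fL'; have -> : f (RLL L L' a b) = map_mx f (RLL L L') a b.
  by rewrite [RHS]mxE.
have tens11 : (1%:M : 'M[K]_n) *t (1%:M : 'M[K]_n) = 1%:M.
  apply/matrixP => i j; case: (mxtens_indexP i) => i0 i1.
  case: (mxtens_indexP j) => j0 j1; rewrite tensmxE !mxE.
  by rewrite (can_eq (@mxtens_indexK _ _)) xpair_eqE -natrM mulnb.
rewrite map_mxB !map_mxM !map_mxT fL fL' !map_mx1 tens11.
by rewrite !(mulmx1, mul1mx) subrr mxE.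
Qed.

End RLL.

(* Generators l^+_ij (inl (true, (i, j))), l^-_ij (inl (false, (i, j))) and the
   inverses of l^+_ii (inr (true, i)) and l^-_ii (inr (false, i)). *)
Definition U_free : algType K :=
  free_alg K ((bool * ('I_n * 'I_n)) + (bool * 'I_n))%type.

Definition U_free_L (s : bool) : 'M[U_free]_n :=
  \matrix_(i, j) free_gen K (inl (s, (i, j))).

Definition U_free_LV (s : bool) (i : 'I_n) : U_free := free_gen K (inr (s, i)).

Inductive U_rel : U_free -> Prop :=
| U_triang_plus (i j : 'I_n) of (j < i)%N : U_rel (U_free_L true i j)
| U_triang_minus (i j : 'I_n) of (i < j)%N : U_rel (U_free_L false i j)
| U_plus_plus a b : U_rel (RLL (U_free_L true) (U_free_L true) a b)
| U_minus_minus a b : U_rel (RLL (U_free_L false) (U_free_L false) a b)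
| U_plus_minus a b : U_rel (RLL (U_free_L true) (U_free_L false) a b)
| U_mulrV s i : U_rel (U_free_L s i i * U_free_LV s i - 1)
| U_mulVr s i : U_rel (U_free_LV s i * U_free_L s i i - 1).

Let v (g : (bool * ('I_n * 'I_n)) + (bool * 'I_n)) : K :=
  match g with inl (_, (i, j)) => (i == j)%:R | inr _ => 1 end.

Lemma U_proper : ~ two_sided_ideal U_rel 1.
Proof.
have ev_L s i j : free_eval v (U_free_L s i j) = (i == j)%:R.
  by rewrite mxE free_eval_gen.
have ev_Lmx s : map_mx (free_eval v) (U_free_L s) = 1%:M.
  by apply/matrixP => i j; rewrite [LHS]mxE ev_L mxE.
apply: (free_eval_proper (v := v)) => x.
case=> [i j ij|i j ij|a b|a b|a b|s i|s i].
- by rewrite ev_L -val_eqE gtn_eqF.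
- by rewrite ev_L -val_eqE ltn_eqF.
- exact: RLL_point.
- exact: RLL_point.
- exact: RLL_point.
- by rewrite rmorphB rmorphM /= ev_L free_eval_gen rmorph1 eqxx mulr1 subrr.
- by rewrite rmorphB rmorphM /= ev_L free_eval_gen rmorph1 eqxx mulr1 subrr.
Qed.

Definition U_alg : algType K := quot_alg U_proper.

Definition U_Lplus : 'M[U_alg]_n := map_mx (quot_proj U_proper) (U_free_L true).
Definition U_Lminus : 'M[U_alg]_n := map_mx (quot_proj U_proper) (U_free_L false).

Definition U_Lspec (z : K) : 'M[U_alg]_n :=
  \matrix_(i, j) (z *: U_Lplus i j - z^-1 *: U_Lminus i j).

Definition c_elt (x : K) : U_alg :=
  \sum_(s : 'S_n) \sum_(t : 'S_n) (perm_weight p s * perm_weight q t) *: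
    \prod_(k < n) U_Lspec (x / u ^+ rev_ord k) (s (rev_ord k)) (t (rev_ord k)).

End RMatrices.

Definition qnumber (K : fieldType) (v : K) (m : nat) : K := \sum_(i < m) v ^+ i.

Definition qfactorial (K : fieldType) (v : K) (m : nat) : K :=
  \prod_(i < m) qnumber v i.+1.

Section CapelliOperators.
Variables (K : fieldType) (n : nat) (u : K) (p q : 'M[K]_n).
Variable HG : hopf_algebra (GL_alg u p q).
Variable pr : U_alg u p q -> GL_alg u p q -> K.

(* The (i, j) entry of ∂(z): the defining equation is for the transpose. *)
Definition partial (z : K) (i j : 'I_n) (f : GL_alg u p q) : GL_alg u p q :=
  (u - u^-1)^-1 *:
    \sum_(k < n) lact HG pr (U_Lspec u p q z j k) f * antipode HG (GL_t u p q k i).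

Definition rdet_partial (x : K) (f : GL_alg u p q) : GL_alg u p q :=
  \sum_(s : 'S_n) perm_weight (map_mx GRing.inv p) s *:
    (\big[(fun D E => D \o E)/id]_(k < n) partial x k (s k)) f.

Definition d_op (x : K) (f : GL_alg u p q) : GL_alg u p q :=
  ((u - u^-1) ^- n * (qfactorial (u ^+ 2) n)^-1) *: ract HG pr (c_elt u p q x) f.

End CapelliOperators.

(* Main.v *)
(* Attach anticommuting variables: let xi_i satisfy xi_i xi_j = - p_ij xi_j xi_i
   and zeta_i the same relations for 1/p, both commuting with all operators on
   the quantum group.  The left action is conjugate to the right one,
   T (L^±.f) = (f.L^±) T, so that up to a scalar the transpose of ∂(x) is
   S(T) L(x)°.  Hence rdet(∂(x)) is the coefficient of xi_1 ... xi_n in the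
   product of the omega_j(x) = sum_k theta_k L_kj(x)°, theta_k = sum_i xi_i S(t_ik).
   Contracted with theta, the R-matrix exchange of L^± and S(T) becomes scalar:
   omega_j(x) theta_l = - theta_l omega_j(xu).  Moving all theta's to the left
   therefore produces the shifted spectral parameters of the Capelli element,
   and theta_1 ... theta_n = xi_1 ... xi_n det_p(T)^-1.  Finally the rows
   v_j(x) = sum_i zeta_i L_ij(x)° satisfy v_i(x) v_j(x/u) = - p_ji v_j(x) v_i(x/u),
   which turns the double sum c(x)° into [n]! times its term with tau = 1. *)

From HB Require Import structures.
Require Import Defs.
From mathcomp Require Import all_boot all_order all_algebra.
From mathcomp Require Import fingroup perm.
From mathcomp Require Import reals boolp.
From mathcomp Require Import ring.
From mathcomp.real_closed Require Import complex mxtens.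
From mathcomp.multinomials Require Import monalg.

Set Implicit Arguments.
Unset Strict Implicit.
Unset Printing Implicit Defensive.

Import GRing.Theory.
Local Open Scope ring_scope.

(** * Permutation weights *)

(** The anticommuting variables are realized inside an endomorphism algebra: A-valued functions on
    the subsets of the index set are coefficient vectors in the basis of ordered monomials, a
    variable acts as left multiplication, and an operator on the quantum group acts on the values.
    An identity between such operators may then be proved after multiplication by the top product of
    the variables.

    The obstacle is that theta does not commute with L°, so a product of omega's does not expand
    into a determinant. Moving every theta to the front leaves the nested expression theta_a
    (theta_b (...) L_b) L_a. Read as a composite of left and right multiplications applied to 1, it
    does expand, because the two kinds of multiplication always commute. The right factors come out
    in reverse order, and reading a word backwards turns the weights of 1/p into those of p, up to
    the product of all - 1/p_ij. The signs cancel against those of the theta moves, and the product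
    of the p_ij in the theorem cancels the rest. The same device inverts det_p(T).

    Relations of S(T) are never written out: they are tested after multiplication by T on the
    right. *)

Section Weights.
Variables (K : fieldType) (n : nat).
Implicit Types (w : 'M[K]_n) (s : 'S_n).

Definition inv_weight w (a b : 'I_n) : K := if (b < a)%N then - w b a else 1.

Lemma perm_weightE w s :
  perm_weight w s =
    \prod_(i < n) \prod_(j < n | (i < j)%N) inv_weight w (s i) (s j).
Proof.
rewrite /perm_weight /perm_length -prodr_const.
under [X in X * _]eq_bigl do rewrite inE.
rewrite -(pair_big_dep xpredT (fun i j : 'I_n => (i < j)%N && (s j < s i)%N)
  (fun _ _ => -1 : K)) /= -big_split /=.
apply: eq_bigr => i _; rewrite -big_split /= big_mkcondr /=.
by apply: eq_bigr => j _; rewrite /inv_weight; case: ifP; rewrite ?mulN1r.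
Qed.

Fixpoint word_weight w (t : seq 'I_n) : K :=
  if t is x :: t' then (\prod_(y <- t') inv_weight w x y) * word_weight w t' else 1.

Lemma word_weightE w m (f : 'I_m -> 'I_n) :
  word_weight w [seq f k | k <- enum 'I_m] =
    \prod_(i < m) \prod_(j < m | (i < j)%N) inv_weight w (f i) (f j).
Proof.
elim: m f => [|m IHm] f; first by rewrite enum_ord0 big_ord0.
rewrite enum_ordSl /= -map_comp IHm big_ord_recl; congr (_ * _).
  rewrite [RHS]big_mkcond [RHS]big_ord_recl /= mul1r big_map big_enum /=.
  by apply: eq_bigr.
apply: eq_bigr => i _; rewrite [RHS]big_mkcond big_ord_recl /= mul1r.
by rewrite big_mkcond; apply: eq_bigr => j _; rewrite /= ltnS.
Qed.

(** The product runs over unordered pairs, so relabelling cannot change it. Pairs whose order [s]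
    keeps give the same factors on both sides; the inverted ones are swapped, which [Gsym]
    absorbs. *)
Lemma prod_pairs_perm (G : 'I_n -> 'I_n -> K) s :
  (forall a b, G a b = G b a) ->
  \prod_(i < n) \prod_(j < n | (i < j)%N) G (s i) (s j) =
  \prod_(i < n) \prod_(j < n | (i < j)%N) G i j.
Proof.
move=> Gsym; pose t := (s^-1)%g.
have -> : \prod_(i < n) \prod_(j < n | (i < j)%N) G (s i) (s j) =
    \prod_(a < n) \prod_(b < n | (t a < t b)%N) G a b.
  rewrite (reindex_inj (@perm_inj _ t)); apply: eq_bigr => a _ /=.
  rewrite (reindex_inj (@perm_inj _ t)); apply: eq_bigr => b _ /=.
  by rewrite !permKV.
have split2 (P Q : rel 'I_n) : (forall a b, a != b -> Q a b = ~~ Q b a) ->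
   (forall a, ~~ P a a) ->
   \prod_a \prod_(b | P a b) G a b =
   (\prod_a \prod_(b | P a b && Q a b) G a b) *
   (\prod_a \prod_(b | P b a && Q a b) G a b).
  move=> PQ PP; rewrite [X in _ * X](exchange_big_dep xpredT) //= -big_split.
  apply: eq_bigr => a _; rewrite (bigID (Q a)) /=; congr (_ * _).
  apply: eq_big => [b|b _]; last exact: Gsym.
  have [->|ab] := eqVneq a b; first by rewrite (negbTE (PP b)).
  by rewrite [Q b a]PQ 1?eq_sym.
have ltX (r : 'S_n) a b : a != b -> (r a < r b)%N = ~~ (r b < r a)%N.
  rewrite -(inj_eq (@perm_inj _ r)) -(inj_eq val_inj) /=.
  by case: ltngtP.
rewrite (split2 _ (fun a b => a < b)%N) => [|a b /(ltX 1%g)|a]; last 2 first.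
- by rewrite !perm1.
- by rewrite ltnn.
rewrite [RHS](split2 _ (fun a b => t a < t b)%N) => [|a b /(ltX t)|a] //; last first.
  by rewrite ltnn.
congr (_ * _).
  by apply: eq_bigr => a _; apply: eq_bigl => b; rewrite andbC.
rewrite (exchange_big_dep xpredT) //=; apply: eq_bigr => a _.
by apply: eq_big => [b|b _]; [rewrite andbC | rewrite Gsym].
Qed.

(** Since [(s * t)%g] applies [s] first, [rev_perm * s] is the word of [s] read backwards. *)
Definition rev_perm : 'S_n := perm (@rev_ord_inj n).

(* Off the diagonal, the inversion weight of (b, a) for 1/w is that of (a, b)
   for w times a factor which is symmetric in a and b. *)
Lemma perm_weight_rev w s : (forall i j, w i j != 0) ->
  perm_weight (map_mx GRing.inv w) (rev_perm * s)%g =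
  (\prod_(i < n) \prod_(j < n | (i < j)%N) (- (w i j)^-1)) * perm_weight w s.
Proof.
move=> w0; pose G (a b : 'I_n) : K :=
  if (a < b)%N then - (w a b)^-1 else if (b < a)%N then - (w b a)^-1 else 1.
have Gsym a b : G a b = G b a by rewrite /G; case: ltngtP.
have -> : \prod_(i < n) \prod_(j < n | (i < j)%N) (- (w i j)^-1) =
    \prod_(i < n) \prod_(j < n | (i < j)%N) G (s i) (s j).
  rewrite prod_pairs_perm //; apply: eq_bigr => i _.
  by apply: eq_bigr => j ij; rewrite /G ij.
rewrite !perm_weightE (reindex_inj (@rev_ord_inj n)) /=.
have -> : \prod_(j < n) \prod_(j0 < n | (rev_ord j < j0)%N)
    inv_weight (map_mx GRing.inv w) ((rev_perm * s)%g (rev_ord j))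
      ((rev_perm * s)%g j0) =
    \prod_(j < n) \prod_(i < n | (i < j)%N)
      inv_weight (map_mx GRing.inv w) (s j) (s i).
  apply: eq_bigr => j _; rewrite (reindex_inj (@rev_ord_inj n)) /=.
  apply: eq_big => [i|i _]; last by rewrite !permM !permE !rev_ordK.
  have := ltn_ord i; have := ltn_ord j => jn iN.
  by rewrite ltn_sub2lE.
rewrite (exchange_big_dep xpredT) //= -big_split; apply: eq_bigr => i _ /=.
rewrite -big_split; apply: eq_bigr => j ij /=.
have : s i != s j by rewrite (inj_eq perm_inj) -(inj_eq val_inj) ltn_eqF.
rewrite -(inj_eq val_inj) /G /inv_weight mxE /=.
case: ltngtP => //= _ _; first by rewrite mulr1.
by rewrite mulrNN mulVf.
Qed.

Lemma perm_weight1 w : perm_weight w 1%g = 1.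
Proof.
rewrite perm_weightE big1 // => i _; rewrite big1 // => j ij.
by rewrite !perm1 /inv_weight ltnNge ltnW.
Qed.

End Weights.

Lemma lt_bump i j : (bump i j < i)%N = (j < i)%N.
Proof.
rewrite /bump; have [ij|ij] := leqP i j; last by rewrite add0n ij.
by rewrite add1n ltnNge leqW.
Qed.

(** Rodrigues' generating function of inversions. A permutation of n+1 points amounts to its value i
    at position 0 and a permutation of n points; position 0 takes part in exactly i inversions, so
    summing over i splits off the factor [n+1]_v. *)
Lemma sum_inversions (K : fieldType) (v : K) n :
  \sum_(s : 'S_n) \prod_(i < n) \prod_(j < n | (i < j)%N)
    (if (s j < s i)%N then v else 1) = qfactorial v n.
Proof.
elim: n => [|n IHn].
  rewrite /qfactorial big_ord0 (eq_bigr (fun _ => 1)) => [|s _]; last by rewrite big_ord0.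
  by rewrite sumr_const card_Sn.
pose h (x : 'I_n.+1 * 'S_n) := lift_perm ord0 x.1 x.2.
have h_bij : bijective h.
  apply: inj_card_bij => [[i s] [j t] /= /permP e|]; last first.
    by rewrite card_prod !card_Sn card_ord factS.
  have ij : i = j by have := e ord0; rewrite !lift_perm_id.
  congr (_, _) => //; apply/permP => k; have := e (lift ord0 k).
  by rewrite !lift_perm_lift ij => /lift_inj.
rewrite (reindex h) /=; last exact: onW_bij.
rewrite -(pair_bigA _ (fun i s => \prod_(i0 < n.+1) \prod_(j < n.+1 | (i0 < j)%N)
    (if (h (i, s) j < h (i, s) i0)%N then v else 1))) /=.
have -> : qfactorial v n.+1 = qnumber v n.+1 * qfactorial v n.
  by rewrite /qfactorial big_ord_recr mulrC.
rewrite mulr_suml.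
apply: eq_bigr => i _; rewrite -IHn mulr_sumr; apply: eq_bigr => s _.
rewrite big_ord_recl; congr (_ * _).
  rewrite big_mkcond big_ord_recl /= mul1r /h /= lift_perm_id.
  under eq_bigr do rewrite lift_perm_lift /= lt_bump.
  transitivity (\prod_(j < n) if (j < i)%N then v else 1).
    by rewrite [RHS](reindex_inj (@perm_inj _ s)).
  rewrite -big_mkcond -(big_ord_widen n (fun=> v)) ?prodr_const ?card_ord //.
  by rewrite -ltnS.
apply: eq_bigr => k _; rewrite big_mkcond big_ord_recl /= mul1r [RHS]big_mkcond.
by apply: eq_bigr => j _; rewrite !lift_perm_lift /= ltnS [in LHS]ltnNge leq_bump2 -ltnNge.
Qed.

(** * Products of Grassmann variables *)

Section Grassmann.
Variables (K : fieldType) (n : nat) (w : 'M[K]_n) (E : algType K).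

(* Letters are indexed by their position in a word, which allows a spectral
   parameter that changes along the word. *)
Definition grassmann (g : nat -> 'I_n -> E) :=
  (forall k i, g k i * g k.+1 i = 0) /\
  (forall k i j, i != j ->
     g k i * g k.+1 j = - w j i *: (g k j * g k.+1 i)).

Variables (g : nat -> 'I_n -> E) (gP : grassmann g).

Let ord_lt : rel 'I_n := fun a b => (a < b)%N.

Let ord_lt_trans : transitive ord_lt.
Proof. by move=> b a c; apply: ltn_trans. Qed.

Fixpoint word_prod k (t : seq 'I_n) : E :=
  if t is x :: t' then g k x * word_prod k.+1 t' else 1.

(** One pass of insertion sort: [x] moves right past each smaller letter [y] at the cost [- w y x],
    and the larger letters contribute the default value 1 of [inv_weight]. The word [t'] is chosen
    before [k] because the tail of a word starts at position k+1. *)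
Lemma word_prod_insert x t : sorted ord_lt t -> x \notin t ->
  exists t', [/\ sorted ord_lt t', perm_eq (x :: t) t' &
    forall k, word_prod k (x :: t) =
      (\prod_(y <- t) inv_weight w x y) *: word_prod k t'].
Proof.
elim: t => [|y t IHt] st xt.
  by exists [:: x]; split=> // k; rewrite big_nil scale1r.
move: (st) => /=; rewrite path_sortedE // => /andP[/allP ylt st'].
move: xt; rewrite inE negb_or => /andP[xy xt].
have [{}xy|yx] := ltnP x y.
  exists (x :: y :: t); split; [by apply/andP; split | exact: perm_refl |].
  move=> k; rewrite big_seq big1 ?scale1r // => z zt; rewrite /inv_weight ltnNge ltnW //.
  move: zt; rewrite inE => /predU1P[->//|/ylt]; exact: ltn_trans.
have {}yx : (y < x)%N by rewrite ltn_neqAle yx andbT eq_sym.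
have [t' [st2 pt' et']] := IHt st' xt.
exists (y :: t'); split.
- rewrite /= path_sortedE // st2 andbT; apply/allP => z.
  by rewrite -(perm_mem pt') inE => /predU1P[->//|/ylt].
- rewrite -(perm_cons y) in pt'; apply: perm_trans pt'.
  by apply/seq.permP => a /=; rewrite addnCA.
move=> k; have /= et := et' k.+1.
rewrite /= mulrA gP.2 // -scalerAl -mulrA et -scalerAr scalerA big_cons.
by rewrite /inv_weight yx.
Qed.

Lemma word_prod_sort t : uniq t ->
  exists t', [/\ sorted ord_lt t', perm_eq t t' &
    forall k, word_prod k t = word_weight w t *: word_prod k t'].
Proof.
elim: t => [|x t IHt] /=; first by exists [::]; split=> // k; rewrite scale1r.
move=> /andP[xt /IHt[t1 [st1 p1 e1]]].
rewrite (perm_mem p1) in xt.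
have [t2 [st2 p2 e2]] := word_prod_insert st1 xt.
exists t2; split=> //; first by rewrite (perm_trans _ p2) // perm_cons.
move=> k; rewrite e1 -scalerAr -[_ * _]/(word_prod k (x :: t1)) e2 scalerA.
by rewrite mulrC (perm_big _ p1).
Qed.

(** The head letter moves right until it stands next to its copy, where the product vanishes. *)
Lemma word_prod_dup x t k : x \in t -> word_prod k (x :: t) = 0.
Proof.
elim: t k => // y t IHt k; rewrite inE /= mulrA.
have [->|xy /= xt] := eqVneq x y; first by rewrite gP.1 mul0r.
by rewrite gP.2 // -scalerAl -mulrA -/(word_prod k.+1 (x :: t)) IHt // mulr0 scaler0.
Qed.

Lemma word_prod_nuniq t k : ~~ uniq t -> word_prod k t = 0.
Proof.
elim: t k => // x t IHt k /=; case: (boolP (x \in t)) => /= [xt _|_ /IHt->].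
  exact: word_prod_dup.
by rewrite mulr0.
Qed.

Lemma prod_wordE (f : 'I_n -> 'I_n) :
  \prod_(k < n) g k (f k) = word_prod 0 [seq f k | k <- enum 'I_n].
Proof.
suff gen m k0 (h : 'I_m -> 'I_n) :
    \prod_(k < m) g (k0 + k) (h k) = word_prod k0 [seq h k | k <- enum 'I_m].
  by rewrite -gen.
elim: m k0 h => [|m IHm] k0 h; first by rewrite big_ord0 enum_ord0.
rewrite big_ord_recl enum_ordSl /= addn0 -map_comp -IHm; congr (_ * _).
by apply: eq_bigr => i _; rewrite addSnnS.
Qed.

Lemma grassmann_prod_perm (s : 'S_n) :
  \prod_(k < n) g k (s k) = perm_weight w s *: \prod_(k < n) g k k.
Proof.
have us : uniq [seq s k | k <- enum 'I_n] by rewrite map_inj_uniq ?enum_uniq //;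
  exact: perm_inj.
have [t [st pt et]] := word_prod_sort us.
rewrite prod_wordE et (prod_wordE id) map_id word_weightE -perm_weightE.
congr (_ *: word_prod 0 _).
have st0 : sorted ord_lt (enum 'I_n).
  by rewrite -[sorted _ _]/(sorted (relpre val ltn) _) -sorted_map val_enum_ord iota_ltn_sorted.
apply: (irr_sorted_eq ord_lt_trans) => //; first by move=> a; exact: ltnn.
move=> a; rewrite -(perm_mem pt) mem_enum; apply/mapP; exists (s^-1 a)%g.
  by rewrite mem_enum.
by rewrite permKV.
Qed.

Lemma grassmann_prod_ninj (f : 'I_n -> 'I_n) :
  ~~ injectiveb f -> \prod_(k < n) g k (f k) = 0.
Proof. by move=> nf; rewrite prod_wordE word_prod_nuniq. Qed.

(** The source of all determinants below: after expansion a non-injective choice of indices gives 0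
    and a permutation gives its weight. The entries [X] keep the order of their positions and may
    fail to commute with one another. *)
Lemma grassmann_prod_sum (X : 'I_n -> 'I_n -> E) :
  (forall k i l j, GRing.comm (g k i) (X l j)) ->
  \prod_(k < n) \sum_(i < n) g k i * X k i =
  \prod_(k < n) g k k * \sum_(s : 'S_n) perm_weight w s *: \prod_(k < n) X k (s k).
Proof.
move=> gX; rewrite bigA_distr_bigA /=.
under eq_bigr do rewrite prodrM_comm //.
rewrite (bigID (fun f : {ffun 'I_n -> 'I_n} => injectiveb f)) /= addrC.
rewrite big1 ?add0r => [|f /grassmann_prod_ninj->]; last by rewrite mul0r.
rewrite (reindex (@pval _)) /=; last first.
  exists (insubd (1%g : 'S_n)) => [s _|f fi]; first by apply: val_inj;
    rewrite val_insubd (valP s).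
  by rewrite -[pval _]/(val _) insubdK.
rewrite mulr_sumr; apply: eq_big => [s|s _]; first exact: (valP s).
rewrite pvalE grassmann_prod_perm.
by rewrite -scalerAl -scalerAr.
Qed.

End Grassmann.

(** * Endomorphism algebras *)

Section EndomorphismAlgebra.
Variables (K : fieldType) (V : lmodType K).

Record endo_fun := EndoFun { endo_app :> V -> V; endo_linear : linear endo_app }.

(* A nonzero vector is an argument because algType structures are nontrivial
   rings. *)
Definition endo (v : V) of v != 0 := endo_fun.

Variables (v : V) (v0 : v != 0).
Local Notation End := (endo v0).

HB.instance Definition _ := gen_eqMixin End.
HB.instance Definition _ := gen_choiceMixin End.

Lemma endo_ext (f g : End) : f =1 g -> f = g.
Proof.
case: f g => [f fl] [g gl] /= fg; have {}fg : f = g by apply/funext.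
by case: _ / fg gl => gl; congr EndoFun; exact: Prop_irrelevance.
Qed.

Let linear_zero : linear (fun _ : V => 0 : V).
Proof. by move=> c x y; rewrite scaler0 addr0. Qed.

Let linear_opp (f : End) : linear (fun x => - f x).
Proof. by move=> c x y; rewrite endo_linear opprD scalerN. Qed.

Let linear_add (f g : End) : linear (fun x => f x + g x).
Proof. by move=> c x y; rewrite !endo_linear scalerDr addrACA. Qed.

Let linear_one : linear (fun x : V => x).
Proof. by []. Qed.

Let linear_mul (f g : End) : linear (fun x => f (g x)).
Proof. by move=> c x y; rewrite !endo_linear. Qed.

Let linear_scale (a : K) (f : End) : linear (fun x => a *: f x).
Proof. by move=> c x y; rewrite endo_linear scalerDr !scalerA mulrC. Qed.

Let op0 : End := EndoFun linear_zero.
Let opN (f : End) : End := EndoFun (linear_opp f).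
Let opD (f g : End) : End := EndoFun (linear_add f g).
Let op1 : End := EndoFun linear_one.
Let opM (f g : End) : End := EndoFun (linear_mul f g).
Let opZ (a : K) (f : End) : End := EndoFun (linear_scale a f).

Let opDA : associative opD.
Proof. by move=> f g h; apply: endo_ext => x /=; rewrite addrA. Qed.
Let opDC : commutative opD.
Proof. by move=> f g; apply: endo_ext => x /=; rewrite addrC. Qed.
Let op0D : left_id op0 opD.
Proof. by move=> f; apply: endo_ext => x /=; rewrite add0r. Qed.
Let opND : left_inverse op0 opN opD.
Proof. by move=> f; apply: endo_ext => x /=; rewrite addNr. Qed.

HB.instance Definition _ := GRing.isZmodule.Build End opDA opDC op0D opND.

Let opMA : associative opM.
Proof. by move=> f g h; apply: endo_ext. Qed.
Let op1M : left_id op1 opM.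
Proof. by move=> f; apply: endo_ext. Qed.
Let opM1 : right_id op1 opM.
Proof. by move=> f; apply: endo_ext. Qed.
Let opMDl : left_distributive opM +%R.
Proof. by move=> f g h; apply: endo_ext. Qed.
Let opMDr : right_distributive opM +%R.
Proof.
move=> f g h; apply: endo_ext => x /=.
by have := endo_linear f 1 (g x) (h x); rewrite !scale1r.
Qed.
Let op1_neq0 : op1 != 0.
Proof.
by apply/eqP => /(congr1 (fun f : End => f v)) /= /eqP; rewrite (negbTE v0).
Qed.

HB.instance Definition _ := GRing.Zmodule_isNzRing.Build End
  opMA op1M opM1 opMDl opMDr op1_neq0.

Let opZA a b f : opZ a (opZ b f) = opZ (a * b) f.
Proof. by apply: endo_ext => x /=; rewrite scalerA. Qed.
Let op1Z : left_id 1 opZ.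
Proof. by move=> f; apply: endo_ext => x /=; rewrite scale1r. Qed.
Let opZDr : right_distributive opZ +%R.
Proof. by move=> a f g; apply: endo_ext => x /=; rewrite scalerDr. Qed.
Let opZDl f : {morph opZ^~ f : a b / a + b}.
Proof. by move=> a b; apply: endo_ext => x /=; rewrite scalerDl. Qed.

HB.instance Definition _ := GRing.Zmodule_isLmodule.Build K End
  opZA op1Z opZDr opZDl.

Let opZAl a (f g : End) : a *: (f * g) = a *: f * g.
Proof. by apply: endo_ext. Qed.

HB.instance Definition _ := GRing.Lmodule_isLalgebra.Build K End opZAl.

Let opZAr a (f g : End) : a *: (f * g) = f * (a *: g).
Proof.
by apply: endo_ext => x /=; rewrite (scalable_linear (endo_linear f)).
Qed.

HB.instance Definition _ := GRing.Lalgebra_isAlgebra.Build K End opZAr.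

Lemma endo0 (f : End) : f 0 = 0.
Proof. by have := scalable_linear (endo_linear f) 0 0; rewrite /= !scale0r. Qed.

Lemma endo_mulE (f g : End) x : (f * g) x = f (g x).
Proof. by []. Qed.

Lemma endo_scaleE c (f : End) x : (c *: f) x = c *: f x.
Proof. by []. Qed.

Lemma endo_sumE (I : Type) (r : seq I) (P : pred I) (F : I -> End) x :
  (\sum_(i <- r | P i) F i) x = \sum_(i <- r | P i) F i x.
Proof. exact: (big_morph (fun f : End => f x)). Qed.

End EndomorphismAlgebra.

(** * Exchange relations in components *)

Lemma skew_neq0 (K : fieldType) n (p : 'M[K]_n) :
  (forall i j, p i j * p j i = 1) -> forall i j, p i j != 0.
Proof.
by move=> pp i j; apply: contra_eq_neq (pp i j) => ->; rewrite mul0r eq_sym oner_neq0.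
Qed.

Lemma skew_inv (K : fieldType) n (p : 'M[K]_n) :
  (forall i j, p i j * p j i = 1) -> forall i j, (p i j)^-1 = p j i.
Proof.
by move=> pp i j; apply: (mulfI (skew_neq0 pp i j)); rewrite pp divff ?(skew_neq0 pp).
Qed.

Section RMatrixExchange.
Variables (K : fieldType) (n : nat) (u : K) (p : 'M[K]_n).
Hypothesis u_neq0 : u != 0.
Hypothesis u2_neqN1 : u ^+ 2 != -1.
Hypothesis pij : forall i j : 'I_n, p i j * p j i = 1.

(* R^+ (e = true) and R^- (e = false) are the sums over i, a of
   R_diag e i a e_ii ⊗ e_aa + R_off e i a e_ia ⊗ e_ai. *)
Definition R_diag (e : bool) (i a : 'I_n) : K :=
  if i == a then (if e then u else u^-1)
  else if (i < a)%N then u^-1 * p i a else u * p i a.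

Definition R_off (e : bool) (i a : 'I_n) : K :=
  if e then (if (i < a)%N then u - u^-1 else 0)
  else (if (a < i)%N then u^-1 - u else 0).

(** The inverse of the eigenvalue of the flipped R-matrix on antisymmetric tensors, which is -1/u
    for R^+ and -u for R^-. The other eigenvalue, read off from e_i ⊗ e_i, is u, respectively
    1/u. *)
Definition R_anti (e : bool) : K := if e then - u else - u^-1.

#[local] Arguments R_diag : simpl never.
#[local] Arguments R_off : simpl never.
#[local] Arguments R_anti : simpl never.

Variable E : algType K.

Let p_neq0 := skew_neq0 pij.

Let pV := skew_inv pij.

Lemma grassmann_R e (g : 'I_n -> E) j b :
  grassmann (map_mx GRing.inv p) (fun=> g) ->
  g j * g b = R_anti e *: (R_diag e j b *: (g b * g j) + R_off e b j *: (g j * g b)).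
Proof.
move=> [g0 /(_ 0%N b j) gs]; have [->|jb] := eqVneq j b.
  by rewrite (g0 0%N) !scaler0 addr0 scaler0.
rewrite [g b * _]gs 1?eq_sym // mxE pV scalerA -scalerDl scalerA -[LHS]scale1r.
congr (_ *: _); rewrite /R_diag (negbTE jb) /R_off /R_anti.
have := pij j b; move: jb; rewrite -(inj_eq val_inj) /=.
by case: ltngtP => //= _ _ pjb; case: e; field: pjb.
Qed.

(** Converse of [grassmann_R]. For j = b the hypothesis reads (1 + u^2) g_i^2 = 0, so squares vanish
    because the eigenvalues u and -1/u of the flipped R^+ differ. *)
Lemma R_grassmann (g : 'I_n -> E) :
  (forall j b, g j * g b =
     R_anti true *: (R_diag true j b *: (g b * g j) + R_off true b j *: (g j * g b))) ->
  grassmann (map_mx GRing.inv p) (fun=> g).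
Proof.
move=> gR; have lt (j b : 'I_n) : (j < b)%N -> g j * g b = - p j b *: (g b * g j).
  move=> jb; rewrite [LHS]gR /R_off /R_diag /R_anti jb ltnNge (ltnW jb) /=.
  rewrite -(inj_eq val_inj) /= ltn_eqF // scale0r addr0 scalerA; congr (_ *: _).
  by field.
split=> [_ i|_ i j].
  have /eqP := gR i i; rewrite /R_diag /R_off /R_anti eqxx ltnn scale0r addr0 scalerA.
  rewrite -[X in X == _]scale1r -subr_eq0 -scalerBl scaler_eq0 => /orP[|/eqP//].
  by rewrite mulNr opprK addrC addr_eq0 -expr2 (negbTE u2_neqN1).
rewrite mxE pV -(inj_eq val_inj) neq_ltn => /orP[ij|ji]; first exact: lt.
by rewrite [g j * g i]lt // scalerA mulrNN pij scale1r.
Qed.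

(** The relation R^+ X'_2 X_1 = X_1 X'_2 R^+ in components. The factors stand in the order opposite
    to the defining relations of U(R), because a |-> a° reverses products; for X = X' = T it is the
    relation of quantum matrices. *)
Definition R_exchange (X X' : 'I_n -> 'I_n -> E) := forall i a j b,
  R_diag true i a *: (X' a b * X i j) + R_off true i a *: (X' i b * X a j) =
  R_diag true j b *: (X i j * X' a b) + R_off true b j *: (X i b * X' a j).

(** What remains of [R_exchange] once the row indices are contracted with Grassmann variables: the
    R-matrix acting on the rows becomes the scalar 1 / [R_anti], and only the one acting on the
    columns survives. *)
Definition R_commute (v v' : 'I_n -> E) := forall j b,
  R_diag true j b *: (v j * v' b) + R_off true b j *: (v b * v' j) =
  (R_anti true)^-1 *: (v' b * v j).

Lemma grassmann_commute (g : 'I_n -> E) :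
  grassmann p (fun=> g) -> R_commute g g.
Proof.
move=> [g0 /(_ 0%N) gs] j b; have [->|jb] := eqVneq j b.
  by rewrite (g0 0%N) !scaler0 addr0.
rewrite [g j * _]gs // scalerA -scalerDl.
congr (_ *: _); rewrite /R_diag (negbTE jb) /R_off /R_anti.
have := pij j b; move: jb; rewrite -(inj_eq val_inj) /=.
by case: ltngtP => //= _ _ pjb; field: pjb; rewrite ?oppr_eq0 ?u_neq0.
Qed.

Lemma commute_row (X X' : 'I_n -> 'I_n -> E) (z : 'I_n -> E) :
  grassmann p (fun=> z) ->
  (forall i j k, GRing.comm (z i) (X j k)) ->
  (forall i j k, GRing.comm (z i) (X' j k)) ->
  R_exchange X X' ->
  R_commute (fun j => \sum_i z i * X i j) (fun j => \sum_i z i * X' i j).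
Proof.
move=> /grassmann_commute zz zX zX' XX' j b.
have exp (Y Y' : 'I_n -> 'I_n -> E) j' b' :
    (forall i j k, GRing.comm (z i) (Y j k)) ->
    (\sum_i z i * Y i j') * (\sum_i z i * Y' i b') =
    \sum_i \sum_a (z i * z a) * (Y i j' * Y' a b').
  move=> zY; rewrite mulr_suml; apply: eq_bigr => i _; rewrite mulr_sumr.
  by apply: eq_bigr => a _; rewrite !mulrA -(mulrA (z i)) -zY !mulrA.
rewrite !exp // !scaler_sumr -big_split /=.
transitivity (\sum_i \sum_a (R_diag true i a *: (z i * z a) + R_off true a i *: (z a * z i))
    * (X' a b * X i j)).
  transitivity (\sum_i \sum_a (z i * z a) * (R_diag true i a *: (X' a b * X i j)
      + R_off true i a *: (X' i b * X a j))).
    apply: eq_bigr => i _; rewrite !scaler_sumr -big_split /=; apply: eq_bigr => a _.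
    by rewrite XX' mulrDr -!scalerAr.
  under eq_bigr do under eq_bigr do rewrite mulrDr -!scalerAr.
  under [RHS]eq_bigr do under eq_bigr do rewrite mulrDl -!scalerAl.
  under eq_bigr do rewrite big_split.
  under [RHS]eq_bigr do rewrite big_split.
  by rewrite !big_split /=; congr (_ + _); exact: exchange_big.
rewrite exchange_big; apply: eq_bigr => i _; rewrite scaler_sumr.
by apply: eq_bigr => a _; rewrite zz -scalerAl.
Qed.

Lemma commute_grassmann (v : 'I_n -> E) :
  R_commute v v -> grassmann p (fun=> v).
Proof.
move=> vR; have lt (j b : 'I_n) : (j < b)%N -> v b * v j = - p j b *: (v j * v b).
  move=> jb; have := vR j b; rewrite /R_off /R_diag /R_anti jb [(b < j)%N]ltnNge (ltnW jb) /=.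
  rewrite -(inj_eq val_inj) /= ltn_eqF // scale0r addr0.
  move=> /(congr1 (fun x => (- u) *: x)); rewrite !scalerA divff ?oppr_eq0 // scale1r => <-.
  by congr (_ *: _); field.
split=> [_ i|_ i j].
  have /eqP := vR i i; rewrite /R_diag /R_off /R_anti eqxx ltnn scale0r addr0.
  rewrite -subr_eq0 -scalerBl scaler_eq0 => /orP[|/eqP//].
  have -> : u - (- u)^-1 = (u ^+ 2 + 1) / u by rewrite invrN opprK; field.
  by rewrite mulf_eq0 invr_eq0 (negbTE u_neq0) orbF addr_eq0 (negbTE u2_neqN1).
rewrite -(inj_eq val_inj) neq_ltn => /orP[ij|ji]; last exact: lt.
by rewrite [v j * v i]lt // scalerA mulrNN pij scale1r.
Qed.

(** The pure terms [vp vp] and [vm vm] anticommute for every parameter. In a product with parameters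
    c and c/u the mixed terms have the coefficients u and 1/u, independent of c; with these
    coefficients, collected in [cross], they anticommute too. This forces the ratio u between
    consecutive parameters. *)
Lemma commute_spectral (vp vm : 'I_n -> E) x : x != 0 ->
  R_commute vp vp -> R_commute vm vm -> R_commute vp vm ->
  grassmann p (fun k i => (x / u ^+ k) *: vp i - (x / u ^+ k)^-1 *: vm i).
Proof.
move=> x0 /commute_grassmann[pp0 /(_ 0%N) pp] /commute_grassmann[mm0 /(_ 0%N) mm] pm.
have pm0 i : vm i * vp i = - u ^+ 2 *: (vp i * vm i).
  have /(congr1 (fun x => (- u) *: x)) := pm i i.
  rewrite /R_diag /R_off /R_anti eqxx ltnn scale0r addr0 !scalerA.
  rewrite divff ?oppr_eq0 // scale1r => <-; congr (_ *: _); ring.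
have lt (j b : 'I_n) : (j < b)%N -> vm b * vp j = - p j b *: (vp j * vm b).
  move=> jb; have := pm j b; rewrite /R_off /R_diag /R_anti jb [(b < j)%N]ltnNge (ltnW jb) /=.
  rewrite -(inj_eq val_inj) /= ltn_eqF // scale0r addr0.
  move=> /(congr1 (fun x => (- u) *: x)); rewrite !scalerA divff ?oppr_eq0 // scale1r => <-.
  by congr (_ *: _); field.
have gt (j b : 'I_n) : (j < b)%N ->
    vm j * vp b = (- u ^+ 2 * p b j) *: (vp b * vm j) + (1 - u ^+ 2) *: (vp j * vm b).
  move=> jb; have := pm b j; rewrite /R_off /R_diag /R_anti jb ltnNge (ltnW jb) /=.
  rewrite -(inj_eq val_inj) /= gtn_eqF //.
  move=> /(congr1 (fun x => (- u) *: x));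
    rewrite scalerDr !scalerA divff ?oppr_eq0 // scale1r => <-.
  by congr (_ *: _ + _ *: _); field.
pose cross i j := u *: (vp i * vm j) + u^-1 *: (vm i * vp j).
have cross_lt (i j : 'I_n) : (i < j)%N -> cross i j = - p j i *: cross j i.
  move=> ij; rewrite /cross gt // lt // !scalerDr !scalerA addrCA -scalerDl.
  by congr (_ *: _ + _ *: _); field: (pij i j).
have crossE i j : i != j -> cross i j = - p j i *: cross j i.
  rewrite -(inj_eq val_inj) neq_ltn => /orP[/cross_lt//|/cross_lt->].
  by rewrite scalerA mulrNN pij scale1r.
have exp c i j : c != 0 -> (c *: vp i - c^-1 *: vm i) *
    ((c / u) *: vp j - (c / u)^-1 *: vm j) =
    (c * (c / u)) *: (vp i * vp j) + (c^-1 * (c / u)^-1) *: (vm i * vm j) - cross i j.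
  move=> c0; rewrite mulrBl !mulrBr -!scalerAl -!scalerAr !scalerA.
  have -> : c * (c / u)^-1 = u by field; rewrite ?c0 ?u_neq0.
  have -> : c^-1 * (c / u) = u^-1 by field; rewrite ?c0 ?u_neq0.
  by rewrite opprB addrACA -opprD.
have xS k : x / u ^+ k.+1 = x / u ^+ k / u by rewrite exprS invfM mulrCA mulrC.
have xk k : x / u ^+ k != 0 by rewrite mulf_neq0 ?invr_neq0 ?expf_neq0.
split=> [k i|k i j ij]; rewrite !xS !exp //.
  rewrite pp0 // mm0 // !scaler0 /cross pm0 scalerA -scalerDl.
  have -> : u + u^-1 * - u ^+ 2 = 0 by field.
  by rewrite scale0r addr0 subr0.
rewrite pp // mm // crossE // !scalerBr !scalerDr !scalerA.
by congr (_ *: _ + _ *: _ - _); rewrite mulrC.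
Qed.

End RMatrixExchange.

(** * Left and right multiplications as commuting operators *)

Section SideMultiplications.
Variables (K : fieldType) (E : algType K).
Local Notation End := (endo (oner_neq0 E)).

Let lmul_linear (a : E) : linear (fun x : E => a * x).
Proof. by move=> c x y; rewrite mulrDr scalerAr. Qed.

Let rmul_linear (a : E) : linear (fun x : E => x * a).
Proof. by move=> c x y; rewrite mulrDl scalerAl. Qed.

(** A nested product a_1 (a_2 (...) b_2) b_1 is a composite of the operators
    [lmul (a_k) * rmul (b_k)] applied to 1. Left and right multiplications commute even when the
    elements do not, so [grassmann_prod_sum] applies to such composites. *)
Definition lmul (a : E) : End := EndoFun (lmul_linear a).
Definition rmul (a : E) : End := EndoFun (rmul_linear a).

Lemma lmulM a b : lmul (a * b) = lmul a * lmul b.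
Proof. by apply: endo_ext => x /=; rewrite mulrA. Qed.

Lemma lmul_is_linear : linear lmul.
Proof. by move=> c a b; apply: endo_ext => x /=; rewrite mulrDl scalerAl. Qed.

HB.instance Definition _ := GRing.isLinear.Build K E End *:%R lmul lmul_is_linear.

Lemma lmul_rmul_comm a b : GRing.comm (lmul a) (rmul b).
Proof. by apply: endo_ext => x /=; rewrite mulrA. Qed.

Lemma prod_lmul m (a : 'I_m -> E) x :
  (\prod_(k < m) lmul (a k)) x = (\prod_(k < m) a k) * x.
Proof.
elim: m a x => [|m IHm] a x; first by rewrite !big_ord0 mul1r.
by rewrite !big_ord_recl endo_mulE /= IHm mulrA.
Qed.

Lemma prod_rmul m (a : 'I_m -> E) x :
  (\prod_(k < m) rmul (a k)) x = x * \prod_(k < m) a (rev_ord k).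
Proof.
elim: m a x => [|m IHm] a x; first by rewrite !big_ord0 mulr1.
rewrite big_ord_recl endo_mulE IHm [in RHS]big_ord_recr /= mulrA.
congr (_ * _ * a _); last by apply: val_inj; rewrite /= subSS subnn.
by apply: eq_bigr => k _; congr a; apply: val_inj; rewrite /= /bump /= add1n subSS -subSn.
Qed.

Lemma grassmann_lmul n (w : 'M[K]_n) (g : nat -> 'I_n -> E) :
  grassmann w g -> grassmann w (fun k i => lmul (g k i)).
Proof.
move=> [g0 gs]; split=> [k i|k i j ij]; first by rewrite -lmulM g0 linear0.
by rewrite -!lmulM gs // linearZ.
Qed.

(* Interleaving reverses the order of the right factors, which turns the
   weights of w into those of 1/w. *)
Lemma grassmann_interleave n (w : 'M[K]_n) (g : 'I_n -> E) (X : 'I_n -> 'I_n -> E) :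
  (forall i j, w i j != 0) ->
  grassmann (map_mx GRing.inv w) (fun=> g) ->
  (\prod_(k < n) \sum_i lmul (g i) * rmul (X i (rev_ord k))) 1 =
  (\prod_(i < n) \prod_(j < n | (i < j)%N) (- (w i j)^-1)) *:
    (\prod_(k < n) g k *
     \sum_(s : 'S_n) perm_weight w s *: \prod_(k < n) X (s k) k).
Proof.
move=> w0 /grassmann_lmul gP.
rewrite (grassmann_prod_sum gP (X := fun k i => rmul (X i (rev_ord k)))); last first.
  by move=> *; exact: lmul_rmul_comm.
rewrite endo_mulE prod_lmul scalerAr; congr (_ * _).
rewrite endo_sumE (reindex_inj (mulgI (rev_perm n))) /= scaler_sumr.
apply: eq_bigr => s _; rewrite prod_rmul mul1r perm_weight_rev // scalerA.
congr (_ *: _); apply: eq_bigr => k _.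
by rewrite permM !permE rev_ordK.
Qed.

End SideMultiplications.

(** * The Capelli identity over Grassmann variables *)

Section GrassmannCapelli.
Variables (K : fieldType) (n : nat) (u : K) (p : 'M[K]_n).
Hypothesis u_neq0 : u != 0.
Hypothesis u2_neqN1 : u ^+ 2 != -1.
Hypothesis pij : forall i j : 'I_n, p i j * p j i = 1.

Variables (E : algType K) (t s : 'I_n -> 'I_n -> E) (M : bool -> 'I_n -> 'I_n -> E).
Variables (xi zeta : 'I_n -> E).
Hypothesis xiP : grassmann (map_mx GRing.inv p) (fun=> xi).
Hypothesis zetaP : grassmann p (fun=> zeta).
Hypothesis xi_t : forall i j k, GRing.comm (xi i) (t j k).
Hypothesis xi_s : forall i j k, GRing.comm (xi i) (s j k).
Hypothesis xi_M : forall e i j k, GRing.comm (xi i) (M e j k).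
Hypothesis zeta_t : forall i j k, GRing.comm (zeta i) (t j k).
Hypothesis zeta_s : forall i j k, GRing.comm (zeta i) (s j k).
Hypothesis zeta_M : forall e i j k, GRing.comm (zeta i) (M e j k).
Hypothesis ts : forall i j, \sum_k t i k * s k j = (i == j)%:R.
Hypothesis st : forall i j, \sum_k s i k * t k j = (i == j)%:R.
Hypothesis t_exchange : R_exchange u p t t.
Hypothesis Mt : forall e i j a b, M e i j * t a b =
  R_diag u p e i a *: (t a b * M e i j) + R_off u e i a *: (t i b * M e a j).
Hypothesis MM : forall e, R_exchange u p (M e) (M e).
Hypothesis MpMm : R_exchange u p (M true) (M false).

Let p_neq0 := skew_neq0 pij.

Let theta k := \sum_i xi i * s i k.
Let omega e j := \sum_i theta i * M e i j.
Let eta j := \sum_k zeta k * t k j.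
Let Mspec (z : K) i j := z *: M true i j - z^-1 *: M false i j.
Let omega_spec z j := \sum_i theta i * Mspec z i j.

Let sum_delta (F : 'I_n -> E) j : \sum_i F i * (i == j)%:R = F j.
Proof.
rewrite (bigD1 j) //= eqxx mulr1 big1 ?addr0 // => i /negbTE->.
by rewrite mulr0.
Qed.

Let cancel_t (x y : 'I_n -> E) :
  (forall b, \sum_l x l * t l b = \sum_l y l * t l b) -> x =1 y.
Proof.
have back (z : 'I_n -> E) l : \sum_b (\sum_k z k * t k b) * s b l = z l.
  under eq_bigr do rewrite mulr_suml.
  rewrite exchange_big -[RHS](sum_delta z); apply: eq_bigr => k _.
  by rewrite -ts mulr_sumr; apply: eq_bigr => b _; rewrite mulrA.
by move=> xy l; rewrite -(back x) -(back y); apply: eq_bigr => b _; rewrite xy.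
Qed.

Let theta_t j : \sum_k theta k * t k j = xi j.
Proof.
rewrite -[RHS](sum_delta xi).
under eq_bigr do rewrite /theta mulr_suml.
rewrite exchange_big; apply: eq_bigr => i _.
by rewrite -st mulr_sumr; apply: eq_bigr => k _; rewrite mulrA.
Qed.

(* Exchanging the two summation indices moves the R-matrix from one side of a
   double sum to the other. *)
Let sum_R_swap e (x y : 'I_n -> 'I_n -> E) :
  \sum_k \sum_c (R_diag u p e k c *: x c k + R_off u e c k *: x k c) * y k c =
  \sum_k \sum_c x c k * (R_diag u p e k c *: y k c + R_off u e k c *: y c k).
Proof.
under eq_bigr do under eq_bigr do rewrite mulrDl -!scalerAl.
under [RHS]eq_bigr do under eq_bigr do rewrite mulrDr -!scalerAr.
under eq_bigr do rewrite big_split.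
under [RHS]eq_bigr do rewrite big_split.
by rewrite !big_split /=; congr (_ + _); exact: exchange_big.
Qed.

(** The two sides of the criterion [R_grassmann] are compared after multiplication by
    [t c b * t k j] and summation. The left side gives [xi j * xi b] by [theta_t]. On the right side
    ([F]) the R-matrix crosses to the t's, passes through them by [t_exchange], and is absorbed by
    the relations of [xi]. Then [cancel_t] is applied twice. *)
Let thetaP : grassmann (map_mx GRing.inv p) (fun=> theta).
Proof.
apply: (R_grassmann u_neq0 u2_neqN1 pij) => k c.
pose F k c := R_anti u true *: (R_diag u p true k c *: (theta c * theta k)
  + R_off u true c k *: (theta k * theta c)).
have tt_theta j b : \sum_k \sum_c theta k * theta c * (t c b * t k j) = xi j * xi b.
  transitivity (\sum_k theta k * (xi b * t k j)).
    apply: eq_bigr => k' _; rewrite -[xi b]theta_t mulr_suml mulr_sumr.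
    by apply: eq_bigr => c' _; rewrite !mulrA.
  rewrite -[xi j]theta_t mulr_suml; apply: eq_bigr => k' _.
  by rewrite xi_t mulrA.
have theta_tt j b : \sum_k \sum_c F k c * (t c b * t k j) = xi j * xi b.
  rewrite [RHS](grassmann_R u_neq0 pij true _ _ xiP) /F.
  under eq_bigr do under eq_bigr do rewrite -scalerAl.
  under eq_bigr do rewrite -scaler_sumr.
  rewrite -scaler_sumr; congr (_ *: _).
  rewrite (sum_R_swap true (fun c k => theta c * theta k) (fun k c => t c b * t k j)).
  under eq_bigr do under eq_bigr do rewrite t_exchange mulrDr -!scalerAr.
  under eq_bigr do rewrite big_split -!scaler_sumr.
  rewrite big_split -!scaler_sumr /=; congr (_ *: _ + _ *: _).
    by rewrite exchange_big tt_theta.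
  by rewrite exchange_big tt_theta.
suff thetaF : (fun c => theta k * theta c) =1 F k by exact: (thetaF c).
apply: cancel_t => b; move: k.
apply: (cancel_t (x := fun k => \sum_c theta k * theta c * t c b)) => j.
transitivity (xi j * xi b); [rewrite -tt_theta | rewrite -theta_tt];
  apply: eq_bigr => a _; rewrite mulr_suml; apply: eq_bigr => d _; by rewrite mulrA.
Qed.

(** After multiplication by t the second theta becomes [xi b], which commutes with M and is expanded
    again as theta times t. The two adjacent theta's then supply, at the cost of [R_anti u e],
    exactly the R-matrix needed to exchange t and M by [Mt]. *)
Let omega_theta e j l : omega e j * theta l = R_anti u e *: (theta l * omega e j).
Proof.
move: l; apply: (cancel_t (y := fun l => R_anti u e *: (theta l * omega e j))) => b.
transitivity (\sum_i \sum_l theta i * theta l * (t l b * M e i j)).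
  under eq_bigr do rewrite -mulrA.
  rewrite -mulr_sumr theta_t mulr_suml; apply: eq_bigr => i _.
  rewrite -mulrA -xi_M -theta_t mulr_suml mulr_sumr.
  by apply: eq_bigr => l _; rewrite !mulrA.
under eq_bigr do under eq_bigr do rewrite (grassmann_R u_neq0 pij e _ _ thetaP) -scalerAl.
rewrite (eq_bigr (fun i => R_anti u e *: \sum_l (R_diag u p e i l *: (theta l * theta i)
  + R_off u e l i *: (theta i * theta l)) * (t l b * M e i j))); last first.
  by move=> i _; rewrite scaler_sumr.
rewrite -scaler_sumr.
rewrite (sum_R_swap e (fun c k => theta c * theta k) (fun k c => t c b * M e k j)).
under eq_bigr do under eq_bigr do rewrite -Mt.
under [RHS]eq_bigr do rewrite -scalerAl.
rewrite -scaler_sumr exchange_big; congr (_ *: _); apply: eq_bigr => l _.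
rewrite -[RHS]mulrA [omega e j * _]mulr_suml mulr_sumr; apply: eq_bigr => i _.
by rewrite !mulrA.
Qed.

Let omega_specE z j : omega_spec z j = z *: omega true j - z^-1 *: omega false j.
Proof.
rewrite /omega_spec !scaler_sumr -sumrB; apply: eq_bigr => i _.
by rewrite mulrBr -!scalerAr.
Qed.

(** The scalars -u for L^+ and -1/u for L^- are, up to the common sign, the effect of z |-> zu on
    the coefficients z and 1/z. *)
Let omega_spec_theta z j l :
  omega_spec z j * theta l = - (theta l * omega_spec (z * u) j).
Proof.
rewrite !omega_specE mulrBl mulrBr -!scalerAl -!scalerAr !omega_theta !scalerA.
by rewrite opprB addrC /R_anti !mulrN !scaleNr opprK invfM.
Qed.

Let prod_omega_theta m z (f : 'I_m -> 'I_n) l :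
  (\prod_(k < m) omega_spec z (f k)) * theta l =
  (-1) ^+ m *: (theta l * \prod_(k < m) omega_spec (z * u) (f k)).
Proof.
elim: m f => [|m IHm] f; first by rewrite !big_ord0 mul1r mulr1 scale1r.
rewrite !big_ord_recl -mulrA IHm -scalerAr [in LHS]mulrA omega_spec_theta mulNr.
by rewrite exprS mulN1r scaleNr scalerN mulrA.
Qed.

(** The theta of the last factor passes all the omega's before it, shifting each of them by u, while
    its own entry of [Mspec] stays at the far right with parameter z. Iteration gives the first
    factor the largest shift, hence the reversed index in [f]. *)
Let prod_omega_interleave m z (f : 'I_m -> 'I_n) :
  \prod_(k < m) omega_spec z (f k) =
  (\prod_(i < m) \prod_(j < m | (i < j)%N) (-1)) *:
    (\prod_(k < m) \sum_l lmul (theta l) *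
      rmul (Mspec (z * u ^+ k) l (f (rev_ord k)))) 1.
Proof.
elim: m z f => [|m IHm] z f; first by rewrite !big_ord0 scale1r.
rewrite big_ord_recr /= [omega_spec z (f ord_max)]/omega_spec mulr_sumr.
rewrite (eq_bigr (fun l => (-1) ^+ m *: (theta l * (\prod_(k < m)
    omega_spec (z * u) (f (widen_ord (leqnSn m) k))) * Mspec z l (f ord_max)))); last first.
  by move=> l _; rewrite mulrA prod_omega_theta -scalerAl.
rewrite IHm.
rewrite -scaler_sumr big_ord_recr /= (_ : \prod_(j < m.+1 | (m < j)%N) -1 = 1); last first.
  by apply: big_pred0 => j; rewrite ltnNge -ltnS ltn_ord.
have -> : \prod_(i < m) \prod_(j < m.+1 | (i < j)%N) (-1) =
    (-1) ^+ m * \prod_(i < m) \prod_(j < m | (i < j)%N) (-1) :> K.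
  transitivity (\prod_(i < m) ((-1) * \prod_(j < m | (i < j)%N) (-1) : K)).
    apply: eq_bigr => i _; rewrite big_mkcond big_ord_recr /= ltn_ord mulrC.
    by rewrite -big_mkcond.
  by rewrite big_split /= prodr_const card_ord.
rewrite mulr1 -scalerA big_ord_recl endo_mulE endo_sumE; congr (_ *: _).
rewrite scaler_sumr; apply: eq_bigr => l _.
rewrite endo_mulE /= expr0 mulr1 -scalerAr -scalerAl mulrA; congr (_ *: _).
congr (_ * _ * Mspec _ _ (f _)); last by apply: val_inj; rewrite /= subSS subn0.
congr (endo_app _ _); apply: eq_bigr => k _; apply: eq_bigr => l' _.
rewrite -mulrA -exprS; congr (_ * rmul (Mspec _ _ (f _))).
by apply: val_inj; rewrite /= /bump /= add1n subSS.
Qed.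

Definition quasi_det : E :=
  \sum_(r : 'S_n) perm_weight p r *: \prod_(k < n) t (r k) k.

Definition inverse_det : E :=
  \sum_(r : 'S_n) perm_weight (map_mx GRing.inv p) r *: \prod_(k < n) s (r k) k.

(** The part of c(z)° with the permutation tau fixed to be [f], without the weight of tau. *)
Definition capelli_minor (z : K) (f : 'I_n -> 'I_n) : E :=
  \sum_(r : 'S_n) perm_weight p r *: \prod_(k < n) Mspec (z / u ^+ k) (r k) (f k).

Definition partial_rdet (z : K) : E :=
  \sum_(r : 'S_n) perm_weight (map_mx GRing.inv p) r *:
    \prod_(k < n) \sum_l s (r k) l * Mspec z l k.

Let mapVV : map_mx GRing.inv (map_mx GRing.inv p) = p.
Proof. by apply/matrixP => i j; rewrite !mxE invrK. Qed.

(** The nested product of eta and [s] is computed in two ways. From the inside out it telescopes,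
    since eta times [s] is zeta and zeta commutes with [s]. By [grassmann_interleave] it is, up to a
    constant, the product of the eta's times [inverse_det], and the product of the eta's is that of
    the zeta's times [quasi_det]. *)
Lemma quasi_det_mul_inverse :
  \prod_(k < n) zeta k = (\prod_(k < n) zeta k) * (quasi_det * inverse_det).
Proof.
have eta_s (f : 'I_n -> 'I_n) : (\prod_(k < n) \sum_l lmul (eta l) * rmul (s l (f k))) 1
    = \prod_(k < n) zeta (f k).
  have gen m (h : 'I_m -> 'I_n) :
      (\prod_(k < m) \sum_l lmul (eta l) * rmul (s l (h k))) 1 = \prod_(k < m) zeta (h k).
    elim: m h => [|m IHm] h; first by rewrite !big_ord0.
    rewrite !big_ord_recl endo_mulE IHm endo_sumE /=; set P := \prod_(i < m) _.
    transitivity (\sum_l eta l * s l (h ord0) * P).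
      apply: eq_bigr => l _; rewrite -[RHS]mulrA; congr (_ * _).
      by apply: commr_sym; apply: commr_prod => k _; exact/commr_sym/zeta_s.
    rewrite -mulr_suml; congr (_ * _); rewrite -[RHS](sum_delta zeta).
    under eq_bigr do rewrite /eta mulr_suml.
    rewrite exchange_big; apply: eq_bigr => i _.
    by rewrite -ts mulr_sumr; apply: eq_bigr => k _; rewrite mulrA.
  exact: gen.
have etaP : grassmann p (fun=> eta).
  by apply: (commute_grassmann u_neq0 u2_neqN1 pij); apply: commute_row.
have detE : \prod_(k < n) eta k = (\prod_(k < n) zeta k) * quasi_det.
  by apply: (grassmann_prod_sum zetaP (X := fun k i => t i k)) => *; exact: zeta_t.
have := eta_s (@rev_ord n); rewrite (grassmann_interleave (w := map_mx GRing.inv p));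
  last 2 first.
- by move=> i j; rewrite mxE invr_neq0.
- by rewrite mapVV.
(* Reversing the zeta's costs [perm_weight_rev] at the identity, the same constant as the
   interleaving, so the two cancel. *)
have -> : \prod_(k < n) zeta (rev_ord k) = \prod_(k < n) zeta (rev_perm n k).
  by apply: eq_bigr => k _; rewrite permE.
rewrite (grassmann_prod_perm zetaP).
rewrite -[perm_weight p _](congr1 (fun w => perm_weight w (rev_perm n)) mapVV).
rewrite -[rev_perm n]mulg1 perm_weight_rev ?perm_weight1 ?mulr1 => [|i j]; last first.
  by rewrite mxE invr_neq0.
move=> e; rewrite mulrA -detE; apply/esym; apply: (scalerI _ e).
apply/prodf_neq0 => i _; apply/prodf_neq0 => j _.
by rewrite oppr_eq0 invr_eq0 mxE invr_neq0.
Qed.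

Lemma capelli_minor_perm z (r : 'S_n) : z != 0 ->
  (\prod_(k < n) zeta k) * capelli_minor z r =
  perm_weight p r *: ((\prod_(k < n) zeta k) * capelli_minor z id).
Proof.
move=> z0; pose v e j := \sum_i zeta i * M e i j.
have vP := commute_spectral u_neq0 u2_neqN1 pij z0 (vp := v true) (vm := v false).
have vE (f : 'I_n -> 'I_n) : (\prod_(k < n) zeta k) * capelli_minor z f =
    \prod_(k < n) ((z / u ^+ k) *: v true (f k) - (z / u ^+ k)^-1 *: v false (f k)).
  rewrite -(grassmann_prod_sum zetaP (X := fun k i => Mspec (z / u ^+ k) i (f k))).
    apply: eq_bigr => k _; rewrite !scaler_sumr -sumrB; apply: eq_bigr => i _.
    by rewrite mulrBr -!scalerAr.
  move=> _ i l j; apply: commrB; rewrite /GRing.comm -scalerAr -scalerAl; congr (_ *: _);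
  exact: zeta_M.
rewrite !vE; apply: (grassmann_prod_perm (g := fun k i =>
  (z / u ^+ k) *: v true i - (z / u ^+ k)^-1 *: v false i)).
by apply: vP => //; apply: commute_row.
Qed.

Lemma partial_rdetE z :
  (\prod_(k < n) xi k) * partial_rdet z =
  (\prod_(i < n) \prod_(j < n | (i < j)%N) (p i j)^-1) *:
  ((\prod_(k < n) xi k) * (inverse_det * capelli_minor (z * u ^+ n.-1) id)).
Proof.
have xi_Mspec z' i j k : GRing.comm (xi i) (Mspec z' j k).
  by apply: commrB; rewrite /GRing.comm -scalerAr -scalerAl xi_M.
have -> : (\prod_(k < n) xi k) * partial_rdet z = \prod_(k < n) omega_spec z k.
  rewrite -(grassmann_prod_sum xiP (X := fun k i => \sum_l s i l * Mspec z l k)).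
    apply: eq_bigr => k _; rewrite /omega_spec /theta.
    under [RHS]eq_bigr do rewrite mulr_suml.
    rewrite exchange_big; apply: eq_bigr => i _.
    by rewrite mulr_sumr; apply: eq_bigr => l _; rewrite mulrA.
  move=> _ i l j; apply: commr_sum => k _; apply: commrM; [exact: xi_s|exact: xi_Mspec].
(* Column k carries the shift u^(n-1-k), that is, the parameter z u^(n-1) / u^k of the Capelli minor
   at z u^(n-1). *)
pose X i (k : 'I_n) := Mspec (z * u ^+ rev_ord k) i k.
rewrite prod_omega_interleave.
rewrite (eq_bigr (fun k => \sum_l lmul (theta l) * rmul (X l (rev_ord k)))); last first.
  by move=> k _; apply: eq_bigr => l _; rewrite /X rev_ordK.
(* For each pair, the sign -1 of a theta move meets the factor - 1/p_ij of the reversal; their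
   product is 1/p_ij. *)
rewrite (grassmann_interleave X p_neq0 thetaP) // scalerA -big_split /=; congr (_ *: _).
  apply: eq_bigr => i _; rewrite -big_split /=; apply: eq_bigr => j _.
  by rewrite mulN1r opprK.
rewrite [X in X * _](grassmann_prod_sum xiP (X := fun k i => s i k)) => [|*]; last exact: xi_s.
rewrite -mulrA; congr (_ * (_ * _)); apply: eq_bigr => r _; congr (_ *: _).
apply: eq_bigr => k _; rewrite /X; congr Mspec; rewrite -mulrA; congr (_ * _) => /=.
have -> : n.-1 = (n - k.+1 + k)%N by rewrite -[in LHS](subnK (ltn_ord k)) addnS.
by rewrite exprD mulfK // expf_neq0.
Qed.

End GrassmannCapelli.

(** * Grassmann variables acting on functions of subsets *)

Section Wedge.
Variables (K : fieldType) (n : nat) (A : algType K).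

(** The value at S is the coefficient of the increasing monomial on S in the quantum exterior
    algebra with coefficients in A. *)
Definition exterior : lmodType K := {ffun {set 'I_n} -> A}.

Lemma exterior_neq0 : [ffun=> 1] != 0 :> exterior.
Proof.
by apply/eqP => /ffunP/(_ set0); rewrite !ffunE => /eqP; rewrite oner_eq0.
Qed.

Local Notation B := (endo (oner_neq0 A)).
Local Notation E := (endo exterior_neq0).

(** The cost of moving the variable [i] from the front to its place in the increasing monomial on
    S. *)
Definition wedge_coef (w : 'M[K]_n) (i : 'I_n) (S : {set 'I_n}) : K :=
  \prod_(j in S | (j < i)%N) (- w j i).

Definition wedge_fun w i (v : exterior) : exterior :=
  [ffun S : {set 'I_n} => if i \in S then wedge_coef w i S *: v (S :\ i) else 0].

Let wedge_linear w i : linear (wedge_fun w i).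
Proof.
move=> c x y; apply/ffunP => S; rewrite !ffunE; case: ifP => _; last first.
  by rewrite scaler0 addr0.
by rewrite scalerDr !scalerA mulrC.
Qed.

Definition wedge w i : E := EndoFun (wedge_linear w i).

Let pointwise_linear (f : B) :
  linear (fun v : exterior => [ffun S => f (v S)] : exterior).
Proof. by move=> c x y; apply/ffunP => S; rewrite !ffunE endo_linear. Qed.

Definition pointwise (f : B) : E := EndoFun (pointwise_linear f).

Lemma pointwiseM f g : pointwise (f * g) = pointwise f * pointwise g.
Proof. by apply: endo_ext => v /=; apply/ffunP => S; rewrite !ffunE. Qed.

Lemma pointwise1 : pointwise 1 = 1.
Proof. by apply: endo_ext => v /=; apply/ffunP => S; rewrite !ffunE. Qed.

Lemma pointwise_is_linear : linear pointwise.
Proof. by move=> c f g; apply: endo_ext => v /=; apply/ffunP => S; rewrite !ffunE. Qed.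

HB.instance Definition _ := GRing.isLinear.Build K B E *:%R pointwise
  pointwise_is_linear.

Lemma pointwise_prod m (f : 'I_m -> B) :
  pointwise (\prod_(k < m) f k) = \prod_(k < m) pointwise (f k).
Proof. exact: (big_morph _ pointwiseM pointwise1). Qed.

Lemma wedge_pointwise w i f : GRing.comm (wedge w i) (pointwise f).
Proof.
apply: endo_ext => v /=; apply/ffunP => S; rewrite !ffunE; case: ifP => _.
  by rewrite (scalable_linear (endo_linear f)).
by rewrite endo0.
Qed.

Lemma wedge_grassmann (w : 'M[K]_n) : (forall i j, w i j * w j i = 1) ->
  grassmann w (fun=> wedge w).
Proof.
move=> ww; have lt (i j : 'I_n) : (i < j)%N ->
    wedge w j * wedge w i = - w i j *: (wedge w i * wedge w j).
  move=> ij; apply: endo_ext => v /=; apply/ffunP => S; rewrite !ffunE.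
  rewrite !in_setD1 -(inj_eq val_inj) /= ltn_eqF //= eq_sym -(inj_eq val_inj) /= ltn_eqF //=.
  case: (boolP (j \in S)) => jS; last by rewrite scaler0 if_same scaler0.
  case: (boolP (i \in S)) => iS; last by rewrite !scaler0.
  rewrite !scalerA setDDl setUC -setDDl; congr (_ *: _).
  rewrite {1}/wedge_coef (bigD1 i) ?iS //= -!mulrA; congr (_ * _).
  rewrite mulrC; congr (_ * _).
    apply: eq_bigl => k; rewrite in_setD1 -(inj_eq val_inj) /=.
    by case: (ltnP k i) => ki; rewrite ?andbF // (ltn_eqF (ltn_trans ki ij)).
  by apply: eq_bigl => k; rewrite in_setD1 andbC andbA.
split=> [_ i|_ i j]; last first.
  rewrite -(inj_eq val_inj) neq_ltn => /orP[ij|]; last exact: lt.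
  by rewrite [wedge w j * _]lt // scalerA mulrNN ww scale1r.
by apply: endo_ext => v /=; apply/ffunP => S; rewrite !ffunE in_setD1 eqxx scaler0 if_same.
Qed.

Definition vacuum (a : A) : exterior := [ffun S => if S == set0 then a else 0].

Lemma wedge_vacuum w (t : seq 'I_n) a : sorted (fun i j : 'I_n => (i < j)%N) t ->
  (\prod_(i <- t) wedge w i) (vacuum a) = [ffun S => if S == [set:: t] then a else 0].
Proof.
elim: t => [|x t IHt] st; first by rewrite big_nil set_nil.
move: st => /=; rewrite path_sortedE; last by move=> ? ? ?; exact: ltn_trans.
move=> /andP[/allP xt /IHt {}IHt]; rewrite big_cons endo_mulE IHt.
apply/ffunP => S; rewrite !ffunE set_cons.
have xNt : x \notin [set:: t] by rewrite inE; apply/negP => /xt; rewrite ltnn.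
have -> : (S == x |: [set:: t]) = (x \in S) && (S :\ x == [set:: t]).
  apply/eqP/andP => [->|[xS /eqP<-]]; last by rewrite setD1K.
  by rewrite setU11 setU1K.
case: (boolP (x \in S)) => //= xS; case: eqP => [St|_]; last by rewrite scaler0.
rewrite /wedge_coef big_pred0 ?scale1r // => j; apply/negP => /andP[jS jx].
have : j \in [set:: t] by rewrite -St in_setD1 jS -(inj_eq val_inj) /= ltn_eqF.
by rewrite inE => /xt xj; have := ltn_trans xj jx; rewrite ltnn.
Qed.

(** Comparison of top coefficients: applied to the constant a, both sides have the values [f a] and
    [g a] at the full set. This strips the variables from the identities of the previous part. *)
Lemma wedge_top_inj w f g :
  (\prod_(k < n) wedge w k) * pointwise f = (\prod_(k < n) wedge w k) * pointwise g ->
  f = g.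
Proof.
move=> fg; apply: endo_ext => a; have := congr1 (fun h : E => h (vacuum a) setT) fg.
have pv (h : B) : pointwise h (vacuum a) = vacuum (h a).
  apply/ffunP => S; rewrite !ffunE; case: ifP => // _.
  exact: endo0.
have -> : \prod_(k < n) wedge w k = \prod_(k <- enum 'I_n) wedge w k.
  by rewrite enumT [index_enum _]unlock.
rewrite !endo_mulE !pv !wedge_vacuum.
  rewrite !ffunE (_ : [set: _] = [set:: enum 'I_n]) ?eqxx //.
  by apply/setP => i; rewrite !inE mem_enum.
all: rewrite -[sorted _ _]/(sorted (relpre val ltn) _) -sorted_map.
all: by rewrite val_enum_ord iota_ltn_sorted.
Qed.

End Wedge.

(** * Actions defined by a Hopf pairing *)

Lemma linear_comb_sum (K : fieldType) (V W : lmodType K) (f : V -> W)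
    (I : Type) (r : seq I) (P : pred I) (c : I -> K) (x : I -> V) : linear f ->
  f (\sum_(i <- r | P i) c i *: x i) = \sum_(i <- r | P i) c i *: f (x i).
Proof.
move=> fl; elim/big_rec2: _ => [|i y1 y2 _ <-]; last exact: fl.
by have := scalable_linear fl 0 0; rewrite /= !scale0r.
Qed.

Section TensorSums.
Variables (K : fieldType) (U V : lmodType K).

Lemma tensor_lift_sum (W : lmodType K) (f : U -> V -> W) (I : Type) (r : seq I)
    (F : I -> tensor U V) :
  bilin f -> tensor_lift f (\sum_(i <- r) F i) = \sum_(i <- r) tensor_lift f (F i).
Proof.
move=> bf; apply: (big_morph (tensor_lift f)) => [s t|]; first exact: tensor_liftD.
exact: tensor_lift0.
Qed.

Lemma tensor_lift_sum_pure (W : lmodType K) (f : U -> V -> W) (I : Type) (r : seq I)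
    (x : I -> U) (y : I -> V) : bilin f ->
  tensor_lift f (\sum_(i <- r) pure_tensor (x i) (y i)) = \sum_(i <- r) f (x i) (y i).
Proof.
move=> bf; rewrite tensor_lift_sum //; apply: eq_bigr => i _.
exact: tensor_lift_pure.
Qed.

Lemma tensor_sum_pure (t : tensor U V) :
  exists s : seq (U * V), t = \sum_(x <- s) pure_tensor x.1 x.2.
Proof.
exists (generic_quotient.repr t); apply: tensor_ext => W f bf.
by rewrite tensor_lift_sum_pure.
Qed.

End TensorSums.

Section PairingActions.
Variables (K : fieldType) (U A : algType K) (HU : hopf_algebra U) (HA : hopf_algebra A).
Variable pr : U -> A -> K.
Hypothesis prP : hopf_pairing HU HA pr.

Let prDl a b c f : pr (c *: a + b) f = c * pr a f + pr b f.
Proof. exact: (pairing_bilin prP).1. Qed.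

Let prDr a c f g : pr a (c *: f + g) = c * pr a f + pr a g.
Proof. exact: (pairing_bilin prP).2. Qed.

Let ract_bilin a : bilin (fun f1 f2 : A => pr a f1 *: f2).
Proof.
split=> [y c x x'|x c y y'] /=; first by rewrite prDr scalerDl scalerA.
by rewrite scalerDr !scalerA mulrC.
Qed.

Let lact_bilin a : bilin (fun f1 f2 : A => pr a f2 *: f1).
Proof.
split=> [y c x x'|x c y y'] /=; last by rewrite prDr scalerDl scalerA.
by rewrite scalerDr !scalerA mulrC.
Qed.

Lemma ract_sumE a f (I : Type) (r : seq I) (x y : I -> A) :
  comul HA f = \sum_(i <- r) pure_tensor (x i) (y i) ->
  ract HA pr a f = \sum_(i <- r) pr a (x i) *: y i.
Proof. by move=> e; rewrite /ract e tensor_lift_sum_pure. Qed.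

Lemma lact_sumE a f (I : Type) (r : seq I) (x y : I -> A) :
  comul HA f = \sum_(i <- r) pure_tensor (x i) (y i) ->
  lact HA pr a f = \sum_(i <- r) pr a (y i) *: x i.
Proof. by move=> e; rewrite /lact e tensor_lift_sum_pure. Qed.

Lemma ract_linear a : linear (ract HA pr a).
Proof. by move=> c f g; rewrite /ract comul_linear tensor_lift_linear. Qed.

Lemma lact_linear a : linear (lact HA pr a).
Proof. by move=> c f g; rewrite /lact comul_linear tensor_lift_linear. Qed.

Lemma ract_linearl f : linear (fun a => ract HA pr a f).
Proof.
move=> c a b; have [s e] := tensor_sum_pure (comul HA f).
rewrite !(ract_sumE _ e) scaler_sumr -big_split; apply: eq_bigr => x _ /=.
by rewrite prDl scalerDl scalerA.
Qed.

Lemma lact_linearl f : linear (fun a => lact HA pr a f).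
Proof.
move=> c a b; have [s e] := tensor_sum_pure (comul HA f).
rewrite !(lact_sumE _ e) scaler_sumr -big_split; apply: eq_bigr => x _ /=.
by rewrite prDl scalerDl scalerA.
Qed.

Lemma ract1 f : ract HA pr 1 f = f.
Proof.
have [s e] := tensor_sum_pure (comul HA f).
rewrite (ract_sumE _ e) -[RHS](counitl HA) e tensor_lift_sum_pure.
  by apply: eq_bigr => x _; rewrite (pairing1l prP).
split=> [y c x x'|x c y y'] /=; last by rewrite scalerDr !scalerA mulrC.
by rewrite counit_linear scalerDl scalerA.
Qed.

Lemma ractM a b f : ract HA pr (a * b) f = ract HA pr b (ract HA pr a f).
Proof.
have [s e] := tensor_sum_pure (comul HA f).
(* The linear map x ⊗ y ⊗ z |-> (a, x)(b, y) z, evaluated on both sides of coassociativity. *)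
pose g (x : A) (t : tensor A A) := pr a x *: tensor_lift (fun y z => pr b y *: z) t.
have gP : bilin g.
  split=> [y c x x'|x c y y'] /=; first by rewrite /g prDr scalerDl scalerA.
  by rewrite /g tensor_lift_linear // scalerDr !scalerA mulrC.
have bil1 (z : A) : bilin (fun x y : A => pure_tensor x (pure_tensor y z)).
  have [pl pr'] := pure_bilin A (tensor A A); have [ql _] := pure_bilin A A.
  split=> [y c x x'|x c y y'] /=; first exact: pl.
  by rewrite (ql z c y y') pr'.
have bil2 : bilin (fun (t : tensor A A) (z : A) =>
    tensor_lift (fun x y => pure_tensor x (pure_tensor y z)) t).
  split=> [y c x x'|x c y y'] /=; first by rewrite tensor_lift_linear.
  have [r ->] := tensor_sum_pure x; rewrite !tensor_lift_sum_pure // scaler_sumr -big_split.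
  have [_ ppr] := pure_bilin A (tensor A A); have [_ qr] := pure_bilin A A.
  by apply: eq_bigr => w _ /=; rewrite (qr w.2 c y y') ppr.
have := congr1 (tensor_lift g) (comulA HA f).
have -> : tensor_map (comul HA) id (comul HA f) =
    \sum_(x <- s) pure_tensor (comul HA x.1) x.2.
  rewrite /tensor_map e tensor_lift_sum_pure //.
  split=> [y c x x'|x c y y'] /=; last exact: (pure_bilin (tensor A A) A).2.
  by rewrite comul_linear; exact: (pure_bilin (tensor A A) A).1.
have -> : tensor_map id (comul HA) (comul HA f) =
    \sum_(x <- s) pure_tensor x.1 (comul HA x.2).
  rewrite /tensor_map e tensor_lift_sum_pure //.
  split=> [y c x x'|x c y y'] /=; first exact: (pure_bilin A (tensor A A)).1.
  by rewrite comul_linear; exact: (pure_bilin A (tensor A A)).2.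
rewrite tensor_lift_sum_pure // /tensor_assoc tensor_lift_sum_pure // tensor_lift_sum // => E.
rewrite (ract_sumE _ e) (ract_sumE _ e).
transitivity (\sum_(x <- s) g x.1 (comul HA x.2)); last first.
  by rewrite linear_comb_sum //; exact: ract_linear.
rewrite -E; apply: eq_bigr => x _.
have [r er] := tensor_sum_pure (comul HA x.1).
have mul_bil : bilin (fun f1 f2 : A => pr a f1 * pr b f2 : K^o).
  split=> [y c x1 x2|x1 c y y'] /=; first by rewrite prDr mulrDl -mulrA.
  by rewrite prDr mulrDr mulrCA.
rewrite (pairingMl prP) er !tensor_lift_sum_pure // scaler_suml.
apply: eq_bigr => y _; rewrite /g tensor_lift_pure //.
by rewrite scalerA.
Qed.

Let comul_mul_sum f g (s r : seq (A * A)) :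
  comul HA f = \sum_(x <- s) pure_tensor x.1 x.2 ->
  comul HA g = \sum_(y <- r) pure_tensor y.1 y.2 ->
  comul HA (f * g) =
    \sum_(x <- [seq (x.1 * y.1, x.2 * y.2) | x <- s, y <- r]) pure_tensor x.1 x.2.
Proof.
move=> e e'; rewrite (comul_monoid HA).2 e e' mulr_suml big_allpairs_dep /=.
apply: eq_bigr => x _; rewrite mulr_sumr; apply: eq_bigr => y _.
by rewrite pureM.
Qed.

Lemma ract_mul a f g (I : finType) (b c : I -> U) :
  comul HU a = \sum_i pure_tensor (b i) (c i) ->
  ract HA pr a (f * g) = \sum_i ract HA pr (b i) f * ract HA pr (c i) g.
Proof.
move=> ea; have [s e] := tensor_sum_pure (comul HA f).
have [r e'] := tensor_sum_pure (comul HA g).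
have eM := comul_mul_sum e e'.
rewrite (ract_sumE _ eM) big_allpairs_dep /=.
under [RHS]eq_bigr do rewrite (ract_sumE _ e) (ract_sumE _ e') mulr_suml.
rewrite [RHS]exchange_big; apply: eq_bigr => x _ /=.
under [RHS]eq_bigr do rewrite mulr_sumr.
rewrite [RHS]exchange_big; apply: eq_bigr => y _ /=.
rewrite (pairingMr prP) ea tensor_lift_sum_pure; last first.
  split=> [z d z1 z2|z1 d z z'] /=; first by rewrite prDl mulrDl -mulrA.
  by rewrite prDl mulrDr mulrCA.
by rewrite scaler_suml; apply: eq_bigr => i _; rewrite -scalerAl -scalerAr scalerA.
Qed.

Lemma lact_mul a f g (I : finType) (b c : I -> U) :
  comul HU a = \sum_i pure_tensor (b i) (c i) ->
  lact HA pr a (f * g) = \sum_i lact HA pr (b i) f * lact HA pr (c i) g.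
Proof.
move=> ea; have [s e] := tensor_sum_pure (comul HA f).
have [r e'] := tensor_sum_pure (comul HA g).
have eM := comul_mul_sum e e'.
rewrite (lact_sumE _ eM) big_allpairs_dep /=.
under [RHS]eq_bigr do rewrite (lact_sumE _ e) (lact_sumE _ e') mulr_suml.
rewrite [RHS]exchange_big; apply: eq_bigr => x _ /=.
under [RHS]eq_bigr do rewrite mulr_sumr.
rewrite [RHS]exchange_big; apply: eq_bigr => y _ /=.
rewrite (pairingMr prP) ea tensor_lift_sum_pure; last first.
  split=> [z d z1 z2|z1 d z z'] /=; first by rewrite prDl mulrDl -mulrA.
  by rewrite prDl mulrDr mulrCA.
by rewrite scaler_suml; apply: eq_bigr => i _; rewrite -scalerAl -scalerAr scalerA.
Qed.

Let comul1 : comul HA 1 = \sum_(i <- [:: tt]) pure_tensor 1 1.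
Proof. by rewrite (comul_monoid HA).1 big_seq1. Qed.

Lemma ract_1 a : ract HA pr a 1 = (counit HU a)%:A.
Proof. by rewrite (ract_sumE _ comul1) big_seq1 (pairing1r prP). Qed.

Lemma lact_1 a : lact HA pr a 1 = (counit HU a)%:A.
Proof. by rewrite (lact_sumE _ comul1) big_seq1 (pairing1r prP). Qed.

End PairingActions.

(** * The R-matrices and the defining relations *)

Section RCoefficients.
Variables (K : fieldType) (n : nat) (u : K) (p q : 'M[K]_n).
Hypothesis u_neq0 : u != 0.
Hypothesis pq : forall i j : 'I_n, (i < j)%N -> p i j * q i j = u ^+ 2.
Hypothesis pij : forall i j : 'I_n, p i j * p j i = 1.

Let pV := skew_inv pij.

Let qE (i j : 'I_n) : (i < j)%N -> q i j = u ^+ 2 * p j i.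
Proof. by move=> ij; rewrite -(pq ij) mulrAC pij mul1r. Qed.

Let sum_pick (P : rel 'I_n) (F : 'I_n -> 'I_n -> K) i a :
  \sum_x \sum_(y | P x y) F x y * ((i == x) && (a == y))%:R = (P i a)%:R * F i a.
Proof.
rewrite (bigD1 i) //= [X in _ + X]big1 ?addr0 => [|x xi]; last first.
  by rewrite big1 // => y _; rewrite [i == x]eq_sym (negbTE xi) mulr0.
rewrite eqxx /=; case: (boolP (P i a)) => Pia; last first.
  rewrite mul0r big1 // => y Piy; case: eqP => [e|]; last by rewrite mulr0.
  by rewrite -e (negbTE Pia) in Piy.
rewrite (bigD1 a) //= eqxx mulr1 mul1r big1 ?addr0 // => y /andP[_ ya].
by rewrite eq_sym (negbTE ya) mulr0.
Qed.

Let tens_delta (x y z w i j a b : 'I_n) :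
  (delta_mx x y *t delta_mx z w : 'M[K]_(n * n))
    (mxtens_index (i, a)) (mxtens_index (j, b)) =
  ((i == x) && (j == y))%:R * ((a == z) && (b == w))%:R.
Proof. by rewrite tensmxE !mxE. Qed.

Let diag_sum (P : rel 'I_n) (F : 'I_n -> 'I_n -> K) i j a b :
  (\sum_x \sum_(y | P x y) F x y *: (delta_mx x x *t delta_mx y y : 'M[K]_(n * n)))
    (mxtens_index (i, a)) (mxtens_index (j, b)) =
  ((i == j) && (a == b))%:R * ((P i a)%:R * F i a).
Proof.
rewrite -sum_pick mulr_sumr summxE; apply: eq_bigr => x _.
rewrite mulr_sumr summxE; apply: eq_bigr => y _; rewrite mxE tens_delta.
have [<-|_] := eqVneq i x; last by rewrite /= mul0r !mulr0.
have [<-|_] := eqVneq a y; last by rewrite /= !mulr0.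
by rewrite mulr1 -natrM mulnb mulrC eq_sym [b == a]eq_sym.
Qed.

Let off_sum (P : rel 'I_n) i j a b :
  (\sum_x \sum_(y | P x y) (delta_mx x y *t delta_mx y x : 'M[K]_(n * n)))
    (mxtens_index (i, a)) (mxtens_index (j, b)) =
  ((i == b) && (a == j))%:R * (P i a)%:R.
Proof.
rewrite -[(P i a)%:R]mulr1 -(sum_pick P (fun _ _ => 1)) mulr_sumr summxE.
apply: eq_bigr => x _; rewrite mulr_sumr summxE; apply: eq_bigr => y _.
rewrite tens_delta mul1r.
have [<-|_] := eqVneq i x; last by rewrite /= mul0r !mulr0.
have [<-|_] := eqVneq a y; last by rewrite /= !(mul0r, mulr0, andbF).
by rewrite andbT mulr1 -natrM mulnb andbC eq_sym [j == a]eq_sym.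
Qed.

Let eq_sum i j a b :
  (\sum_x (delta_mx x x *t delta_mx x x : 'M[K]_(n * n)))
    (mxtens_index (i, a)) (mxtens_index (j, b)) =
  ((i == j) && (a == b))%:R * (i == a)%:R.
Proof.
rewrite summxE (bigD1 i) //= tens_delta eqxx big1 ?addr0 /= => [|x xi].
  have [<-|ia] := eqVneq i a; first by rewrite mulr1 -natrM mulnb eq_sym [b == i]eq_sym.
  by rewrite !mulr0.
by rewrite tens_delta eq_sym (negbTE xi) mul0r.
Qed.

(** For i < j one has q_ij = u^2 p_ji, so q disappears from the R-matrices. R^+ and R^- then share
    all coefficients of e_ii ⊗ e_aa with i different from a. *)
Lemma R_plusE i j a b : tens_coef (R_plus u p q) i j a b =
  ((i == j) && (a == b))%:R * R_diag u p true i a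
  + ((i == b) && (a == j))%:R * R_off u true i a.
Proof.
rewrite /tens_coef /R_plus !mxE diag_sum (diag_sum (fun x y => y < x)%N (fun x y => q y x)).
rewrite eq_sum off_sum; congr (_ + _); last first.
  by rewrite mulrCA; congr (_ * _); rewrite /R_off; case: ifP; rewrite ?mulr1 ?mulr0.
set d := ((i == j) && (a == b))%:R; rewrite /R_diag -(inj_eq val_inj) /=.
case: ltngtP => // ia; rewrite ?(mul0r, mulr0, mul1r, mulr1, add0r, addr0) /=.
- by rewrite mulrCA.
- by rewrite qE //; field.
- by rewrite mulrC.
Qed.

Lemma R_minusE i j a b : tens_coef (R_minus u p q) i j a b =
  ((i == j) && (a == b))%:R * R_diag u p false i a
  + ((i == b) && (a == j))%:R * R_off u false i a.
Proof.
rewrite /tens_coef /R_minus !mxE (diag_sum (fun x y => y < x)%N (fun x y => (p y x)^-1)).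
rewrite (diag_sum (fun x y => x < y)%N (fun x y => (q x y)^-1)).
rewrite eq_sum off_sum; congr (_ + _); last first.
  by rewrite mulrCA; congr (_ * _); rewrite /R_off; case: ifP; rewrite ?mulr1 ?mulr0.
set d := ((i == j) && (a == b))%:R; rewrite /R_diag -(inj_eq val_inj) /=.
case: ltngtP => // ia; rewrite ?(mul0r, mulr0, mul1r, mulr1, add0r, addr0) /=.
- by rewrite pV mulrCA.
- by rewrite qE // invfM pV; field.
- by rewrite mulrC.
Qed.

End RCoefficients.

Section Relations.
Variables (K : fieldType) (n : nat) (u : K) (p q : 'M[K]_n).
Hypothesis u_neq0 : u != 0.
Hypothesis pq : forall i j : 'I_n, (i < j)%N -> p i j * q i j = u ^+ 2.
Hypothesis pij : forall i j : 'I_n, p i j * p j i = 1.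

Let p_neq0 := skew_neq0 pij.

Let qE (i j : 'I_n) : (i < j)%N -> q i j = u ^+ 2 / p i j.
Proof. by move=> ij; rewrite -(pq ij) mulrAC divff ?mul1r. Qed.

Let pE (i j : 'I_n) : p j i = (p i j)^-1.
Proof. by rewrite skew_inv. Qed.

Lemma R_diag_sign e (i a : 'I_n) : R_diag u p e i a =
  R_diag u p true i a - (if e || (i != a) then 0 else u - u^-1).
Proof.
case: e => /=; first by rewrite subr0.
by rewrite /R_diag; case: eqP => _; rewrite ?subr0 // opprB addrC subrK.
Qed.

Lemma R_off_sign e (i a : 'I_n) : R_off u e i a =
  R_off u true i a - (if e || (i == a) then 0 else u - u^-1).
Proof.
case: e => /=; first by rewrite subr0.
rewrite /R_off -(inj_eq val_inj) /=.
by case: ltngtP => _; rewrite ?subr0 ?subrr // sub0r opprB.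
Qed.

(* R^+ - R^- is a multiple of the flip, which exchanges t_1 t_2 and t_2 t_1. *)
Lemma exchange_sign (A : algType K) (X : 'I_n -> 'I_n -> A) e i a j b :
  R_exchange u p X X ->
  R_diag u p e i a *: (X a b * X i j) + R_off u e i a *: (X i b * X a j) =
  R_diag u p e j b *: (X i j * X a b) + R_off u e b j *: (X i b * X a j).
Proof.
move=> XX; rewrite (R_diag_sign e i) (R_off_sign e i) (R_diag_sign e j) (R_off_sign e b).
rewrite !scalerBl addrACA -opprD XX [RHS]addrACA -opprD; congr (_ - _).
case: e => /=; first by rewrite !scale0r.
rewrite [b == j]eq_sym; have [->|_] := eqVneq i a; have [->|_] := eqVneq j b;
  by rewrite /= !scale0r ?add0r ?addr0.
Qed.

Lemma qmatrix_exchange (A : algType K) (T : 'M[A]_n) :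
  (forall x, qmatrix_rel u p q T x -> x = 0) -> R_exchange u p T T.
Proof.
move=> rel.
have row (i k l : 'I_n) : (k < l)%N -> T i k * T i l = q k l *: (T i l * T i k).
  by move=> kl; have /rel/subr0_eq := Qmatrix_row u p q T i kl.
have col (i j k : 'I_n) : (i < j)%N -> T i k * T j k = p i j *: (T j k * T i k).
  by move=> ij; have /rel/subr0_eq := Qmatrix_col u p q T k ij.
have anti (i j k l : 'I_n) : (i < j)%N -> (k < l)%N ->
    T i l * T j k = (p i j / q k l) *: (T j k * T i l).
  move=> ij kl; have /rel/subr0_eq := Qmatrix_anti u p q T ij kl.
  have q0 : q k l != 0 by rewrite qE // mulf_neq0 ?invr_neq0 ?expf_neq0.
  by move=> /(congr1 (fun x => (q k l)^-1 *: x)); rewrite !scalerA mulVf // scale1r mulrC.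
have diag (i j k l : 'I_n) : (i < j)%N -> (k < l)%N ->
    (q k l)^-1 *: (T i k * T j l) - (q i j)^-1 *: (T j l * T i k) =
    (1 - u ^- 2) *: (T i l * T j k).
  by move=> ij kl; have /rel/subr0_eq := Qmatrix_diag u p q T ij kl.
move=> i a j b.
have [<-|] := eqVneq i a; have [<-|] := eqVneq j b.
- by rewrite /R_diag /R_off !eqxx !ltnn.
- rewrite /R_diag /R_off eqxx ltnn -(inj_eq val_inj) /=; case: ltngtP => //= jb _.
    rewrite [T i j * T i b]row // qE // !scale0r !addr0 scalerA; congr (_ *: _);
      by field; rewrite ?p_neq0 ?oner_eq0 ?u_neq0.
  rewrite [T i b * T i j]row // qE // pE scale0r addr0 !scalerA -scalerDl; congr (_ *: _).
  by field; rewrite ?p_neq0 ?oner_eq0 ?u_neq0.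
- rewrite /R_diag /R_off eqxx ltnn -(inj_eq val_inj) /=; case: ltngtP => //= ia _.
    rewrite [T i j * _]col // scale0r addr0 !scalerA -scalerDl; congr (_ *: _); by field;
      rewrite ?p_neq0 ?oner_eq0 ?u_neq0.
  by rewrite !scale0r !addr0 [T a j * _]col // !scalerA pE; congr (_ *: _); field;
    rewrite ?p_neq0 ?oner_eq0 ?u_neq0.
rewrite /R_diag /R_off -!(inj_eq val_inj) /=.
case: (ltngtP j b) => //= jb _; case: (ltngtP i a) => //= ia _; rewrite ?scale0r ?addr0.
- have -> : u^-1 * p i a = u * (q i a)^-1 by rewrite qE //; field; rewrite ?p_neq0.
  have -> : u^-1 * p j b = u * (q j b)^-1 by rewrite qE //; field; rewrite ?p_neq0.
  have -> : u - u^-1 = u * (1 - u ^- 2) by field.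
  by rewrite -!scalerA -diag // scalerBr addrC subrK.
- rewrite (anti a i j b) // scalerA; congr (_ *: _); rewrite qE // (pE a i).
  by field; rewrite ?p_neq0 ?oner_eq0 ?u_neq0.
- congr (_ + _); rewrite (anti i a b j) // scalerA; congr (_ *: _); rewrite qE // (pE b j).
  by field; rewrite ?p_neq0 ?oner_eq0 ?u_neq0.
have /esym := diag _ _ _ _ ia jb; rewrite anti // scalerA => D.
(* The multiple of the relation [D] whose coefficient at [T a b * T i j] is the required
   [u * p i a]. *)
pose k := u * q b j / p a i.
have -> : u * p i a = k * (q b j)^-1.
  by rewrite /k qE // (pE a i); field; rewrite ?p_neq0 ?oner_eq0 ?u_neq0.
have -> : u * p j b = k * (q a i)^-1.
  by rewrite /k !qE // (pE b j); field; rewrite ?p_neq0 ?oner_eq0 ?u_neq0.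
have -> : u - u^-1 = k * ((1 - u ^- 2) * (p a i / q b j)).
  by rewrite /k qE //; field; rewrite ?p_neq0 ?oner_eq0 ?u_neq0.
by rewrite -!(scalerA k) D scalerBr addrC subrK.
Qed.

End Relations.

Lemma sum_mxtens (V : zmodType) m n (F : 'I_(m * n) -> V) :
  \sum_x F x = \sum_i \sum_a F (mxtens_index (i, a)).
Proof.
rewrite pair_bigA /= (reindex (@mxtens_index m n)) /=.
  by apply: eq_bigr => -[].
by exists (@mxtens_unindex m n) => x _; [exact: mxtens_indexK | exact: mxtens_unindexK].
Qed.

Section RSums.
Variables (K : fieldType) (n : nat) (u : K) (p q : 'M[K]_n).
Hypothesis u_neq0 : u != 0.
Hypothesis pq : forall i j : 'I_n, (i < j)%N -> p i j * q i j = u ^+ 2.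
Hypothesis pij : forall i j : 'I_n, p i j * p j i = 1.

Definition R_sign (e : bool) : 'M[K]_(n * n) := if e then R_plus u p q else R_minus u p q.

Lemma R_signE e i j a b : tens_coef (R_sign e) i j a b =
  ((i == j) && (a == b))%:R * R_diag u p e i a
  + ((i == b) && (a == j))%:R * R_off u e i a.
Proof. by case: e; [exact: R_plusE | exact: R_minusE]. Qed.

Lemma sum_delta2 (V : lmodType K) (c : 'I_n -> 'I_n -> K) (F : 'I_n -> 'I_n -> V) i a :
  \sum_k \sum_l (((i == k) && (a == l))%:R * c k l) *: F k l = c i a *: F i a.
Proof.
rewrite (bigD1 i) //= (bigD1 a) //= !eqxx mul1r !big1 ?addr0 // => [k ki|l la].
  by rewrite big1 // => l _; rewrite eq_sym (negbTE ki) mul0r scale0r.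
by rewrite [a == l]eq_sym (negbTE la) mul0r scale0r.
Qed.

Lemma R_row_sum (V : lmodType K) e (F : 'I_n -> 'I_n -> V) i a :
  \sum_k \sum_c tens_coef (R_sign e) i k a c *: F k c =
  R_diag u p e i a *: F i a + R_off u e i a *: F a i.
Proof.
under eq_bigr do under eq_bigr do rewrite R_signE scalerDl.
under eq_bigr do rewrite big_split /=.
rewrite big_split (sum_delta2 (fun _ _ => R_diag u p e i a)); congr (_ + _).
rewrite -(sum_delta2 (fun _ _ => R_off u e i a)).
by apply: eq_bigr => k _; apply: eq_bigr => l _; rewrite andbC.
Qed.

Lemma R_col_sum (V : lmodType K) e (F : 'I_n -> 'I_n -> V) j b :
  \sum_k \sum_c tens_coef (R_sign e) k j c b *: F k c =
  R_diag u p e j b *: F j b + R_off u e b j *: F b j.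
Proof.
under eq_bigr do under eq_bigr do rewrite R_signE scalerDl.
under eq_bigr do rewrite big_split /=.
rewrite big_split /= -(sum_delta2 (fun k l => R_diag u p e k l)).
rewrite -(sum_delta2 (fun k l => R_off u e k l)); congr (_ + _).
  by apply: eq_bigr => k _; apply: eq_bigr => l _; rewrite ![_ == k]eq_sym ![_ == l]eq_sym.
by apply: eq_bigr => k _; apply: eq_bigr => l _; rewrite ![_ == k]eq_sym ![_ == l]eq_sym.
Qed.

Lemma RLL_exchange (A : algType K) (L L' : 'M[A]_n) :
  (forall x y, RLL u p q L L' x y = 0) ->
  forall i a j b,
  R_diag u p true i a *: (L i j * L' a b) + R_off u true i a *: (L a j * L' i b) =
  R_diag u p true j b *: (L' a b * L i j) + R_off u true b j *: (L' a j * L i b).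
Proof.
move=> RL i a j b; have := RL (mxtens_index (i, a)) (mxtens_index (j, b)).
rewrite /RLL -mulmxA !mxE => /subr0_eq; rewrite !sum_mxtens.
have e12 k c j' b' : (tens1 L *m tens2 L') (mxtens_index (k, c)) (mxtens_index (j', b')) =
    L k j' * L' c b'.
  rewrite mxE sum_mxtens (bigD1 j') //= (bigD1 c) //= !big1 => [|l lj|d dc]; last 2 first.
  - by rewrite big1 // => d _; rewrite !tensmxE !mxE (negbTE lj) mul0r mulr0.
  - by rewrite !tensmxE !mxE eq_sym (negbTE dc) mulr0 mul0r.
  by rewrite !addr0 !tensmxE !mxE !eqxx mulr1 mul1r.
have e21 k c j' b' : (tens2 L' *m tens1 L) (mxtens_index (k, c)) (mxtens_index (j', b')) =
    L' c b' * L k j'.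
  rewrite mxE sum_mxtens (bigD1 k) //= (bigD1 b') //= !big1 => [|l lj|d dc]; last 2 first.
  - by rewrite big1 // => d _; rewrite !tensmxE !mxE eq_sym (negbTE lj) !mul0r.
  - by rewrite !tensmxE !mxE (negbTE dc) !mulr0.
  by rewrite !addr0 !tensmxE !mxE !eqxx mulr1 mul1r.
under eq_bigr do under eq_bigr do rewrite e12 mxE mulr_algl.
under [RHS]eq_bigr do under eq_bigr do rewrite e21 mxE mulr_algr.
rewrite (R_row_sum true (fun k c => L k j * L' c b)).
by rewrite (R_col_sum true (fun k c => L' a c * L i k)).
Qed.

End RSums.

(** * Induction on generators *)

Lemma free_alg_ind (K : fieldType) (G : choiceType) (P : free_alg K G -> Prop) :
  P 1 -> (forall c x y, P x -> P y -> P (c *: x + y)) ->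
  (forall x y, P x -> P y -> P (x * y)) -> (forall g, P (free_gen K g)) ->
  forall x, P x.
Proof.
move=> P1 PD PM Pg x.
have P0 : P 0 by rewrite -(addNr 1) -scaleN1r; exact: PD.
have Pmon (m : {fmonom G}) : P << m >>.
  case: m => m; elim: m => [|g m IHm].
    by rewrite -(_ : 1 = << FMonom [::] >> :> {malg K[{fmonom G}]}) //; congr << _ >>;
      apply/eqP; rewrite fmP fm1.
  suff -> : << FMonom (g :: m) >> = free_gen K g * << FMonom m >> :> free_alg K G by apply: PM.
  rewrite /free_gen -[RHS]/(_ * _ : {malg K[{fmonom G}]}) malgM_def fgmulUU mulr1.
  by congr << _ >>; apply/eqP; rewrite fmP fmM fmU.
have -> : x = \sum_(k <- finmap.enum_fset (msupp x)) x@_k *: (<< k >> : free_alg K G).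
  rewrite [LHS]monalgE; apply: eq_bigr => k _.
  by apply/malgP => m; rewrite mcoeffZ !mcoeffU mulrnAr mulr1.
elim: (finmap.enum_fset _) => [|k r IHr]; first by rewrite big_nil.
by rewrite big_cons; apply: PD.
Qed.

(** The extra generator is described only as a two-sided inverse of the determinant, so a
    multiplicative property passes to it by closure under inverses. *)
Lemma GL_alg_ind (K : fieldType) n u (p q : 'M[K]_n) (P : GL_alg u p q -> Prop) :
  P 1 -> (forall c x y, P x -> P y -> P (c *: x + y)) ->
  (forall x y, P x -> P y -> P (x * y)) -> (forall i j, P (GL_t u p q i j)) ->
  (forall d, det_q q (GL_t u p q) * d = 1 -> d * det_q q (GL_t u p q) = 1 -> P d) ->
  forall x, P x.
Proof.
move=> P1 PD PM Pt Pd x.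
pose pi := quot_proj (@GL_proper K n u p q).
have -> : x = pi (generic_quotient.repr x) by rewrite /pi /quot_proj generic_quotient.reprK.
elim/free_alg_ind: (generic_quotient.repr x) => [|c y z Py Pz|y z Py Pz|[[i j]|]].
- by rewrite /pi rmorph1.
- by rewrite /pi linearP; exact: PD.
- by rewrite /pi rmorphM; exact: PM.
- by have := Pt i j; rewrite !mxE.
have pi_det : pi (det_q q (GL_free_t K n)) = det_q q (GL_t u p q).
  rewrite /pi /det_q linear_sum; apply: eq_bigr => s _; rewrite linearZ rmorph_prod /=.
  by congr (_ *: _); apply: eq_bigr => i _; rewrite !mxE.
apply: Pd; rewrite -pi_det /pi -rmorphM; apply/subr0_eq;
  rewrite -(rmorph1 (quot_proj (@GL_proper K n u p q))) -rmorphB;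
  apply/quot_proj_eq0/Ideal_gen; [exact: GL_mulrV | exact: GL_mulVr].
Qed.

(** * Operators on the quantum group *)

Lemma map_RLL (K : fieldType) n u (p q : 'M[K]_n) (A B : algType K)
    (f : {lrmorphism A -> B}) (L L' : 'M[A]_n) :
  map_mx f (RLL u p q L L') = RLL u p q (map_mx f L) (map_mx f L').
Proof.
have fR : map_mx f (map_mx (GRing.in_alg A) (R_plus u p q)) =
    map_mx (GRing.in_alg B) (R_plus u p q).
  by apply/matrixP => x y; rewrite !mxE linearZ rmorph1.
by rewrite map_mxB !map_mxM !map_mxT fR !map_mx1.
Qed.

Section QuantumGroupActions.
Variables (K : fieldType) (n : nat) (u : K) (p q : 'M[K]_n).
Hypothesis u_neq0 : u != 0.
Hypothesis pq : forall i j : 'I_n, (i < j)%N -> p i j * q i j = u ^+ 2.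
Hypothesis pij : forall i j : 'I_n, p i j * p j i = 1.

Variables (A U : algType K) (T : 'M[A]_n) (L : bool -> 'M[U]_n).
Hypothesis A_ind : forall P : A -> Prop,
  P 1 -> (forall c x y, P x -> P y -> P (c *: x + y)) ->
  (forall x y, P x -> P y -> P (x * y)) -> (forall i j, P (T i j)) ->
  (forall d, det_q q T * d = 1 -> d * det_q q T = 1 -> P d) -> forall x, P x.
Hypothesis TT : R_exchange u p T T.

Variable HG : hopf_algebra A.
Hypothesis comul_t : forall i j, comul HG (T i j) = \sum_k pure_tensor (T i k) (T k j).
Hypothesis counit_t : forall i j, counit HG (T i j) = (i == j)%:R.
Variable HU : hopf_algebra U.
Hypothesis comul_L : forall e i j,
  comul HU (L e i j) = \sum_k pure_tensor (L e i k) (L e k j).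
Hypothesis counit_L : forall e i j, counit HU (L e i j) = (i == j)%:R.
Variable pr : U -> A -> K.
Hypothesis prP : hopf_pairing HU HG pr.
Hypothesis pr_L : forall e i j a b,
  pr (L e i j) (T a b) = tens_coef (R_sign u p q e) i j a b.

Local Notation S := (antipode HG).
Local Notation rop a := (ract HG pr a).
Local Notation lop a := (lact HG pr a).

Let ract_t e i j a b :
  rop (L e i j) (T a b) = \sum_c tens_coef (R_sign u p q e) i j a c *: T c b.
Proof. by rewrite (ract_sumE prP _ (comul_t a b)); apply: eq_bigr => c _; rewrite pr_L. Qed.

Let lact_t e i j a b :
  lop (L e i j) (T a b) = \sum_c tens_coef (R_sign u p q e) i j c b *: T a c.
Proof. by rewrite (lact_sumE prP _ (comul_t a b)); apply: eq_bigr => c _; rewrite pr_L. Qed.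

Let ract_t_mul e i j a b f : rop (L e i j) (T a b * f) =
  R_diag u p e i a *: (T a b * rop (L e i j) f)
  + R_off u e i a *: (T i b * rop (L e a j) f).
Proof.
rewrite (ract_mul prP _ _ (comul_L e i j)).
rewrite -(R_row_sum u_neq0 pq pij e (fun k c => T c b * rop (L e k j) f)).
apply: eq_bigr => k _; rewrite ract_t mulr_suml; apply: eq_bigr => c _.
by rewrite scalerAl.
Qed.

Let mul_t_antipode i j : \sum_k T i k * S (T k j) = (i == j)%:R.
Proof.
have := antipoder HG (T i j); rewrite comul_t counit_t tensor_lift_sum_pure => [->|].
  by rewrite scaler_nat.
split=> [y c x x'|x c y y'] /=; first by rewrite mulrDl scalerAl.
by rewrite antipode_linear mulrDr scalerAr.
Qed.

Let mul_antipode_t i j : \sum_k S (T i k) * T k j = (i == j)%:R.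
Proof.
have := antipodel HG (T i j); rewrite comul_t counit_t tensor_lift_sum_pure => [->|].
  by rewrite scaler_nat.
split=> [y c x x'|x c y y'] /=; last by rewrite mulrDr scalerAr.
by rewrite antipode_linear mulrDl scalerAl.
Qed.

(* The elements f with this property form a subalgebra which is closed under
   inverses, and for f = t_ab it is the relation R T_1 T_2 = T_2 T_1 R. *)
Let conjugate_actions e f :
  (\matrix_(i, j) rop (L e i j) f) *m T = T *m (\matrix_(i, j) lop (L e i j) f).
Proof.
pose rmx f := \matrix_(i, j) rop (L e i j) f.
pose lmx f := \matrix_(i, j) lop (L e i j) f.
rewrite -/(rmx f) -/(lmx f).
have rmxM x y : rmx (x * y) = rmx x *m rmx y.
  apply/matrixP => i j; rewrite !mxE (ract_mul prP _ _ (comul_L e i j)).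
  by apply: eq_bigr => k _; rewrite !mxE.
have lmxM x y : lmx (x * y) = lmx x *m lmx y.
  apply/matrixP => i j; rewrite !mxE (lact_mul prP _ _ (comul_L e i j)).
  by apply: eq_bigr => k _; rewrite !mxE.
have rmx1 : rmx 1 = 1%:M.
  by apply/matrixP => i j; rewrite !mxE (ract_1 prP) counit_L scaler_nat.
have lmx1 : lmx 1 = 1%:M.
  by apply/matrixP => i j; rewrite !mxE (lact_1 prP) counit_L scaler_nat.
have PD c x y : rmx x *m T = T *m lmx x -> rmx y *m T = T *m lmx y ->
    rmx (c *: x + y) *m T = T *m lmx (c *: x + y).
  move=> /matrixP ex /matrixP ey; apply/matrixP => i j.
  have := ex i j; have := ey i j; rewrite !mxE => {}ey {}ex.
  transitivity (c *: (\sum_k rmx x i k * T k j) + \sum_k rmx y i k * T k j).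
    rewrite scaler_sumr -big_split; apply: eq_bigr => k _ /=.
    by rewrite !mxE (ract_linear prP) mulrDl scalerAl.
  rewrite ex ey scaler_sumr -big_split; apply: eq_bigr => k _ /=.
  by rewrite !mxE (lact_linear prP) mulrDr scalerAr.
have PM x y : rmx x *m T = T *m lmx x -> rmx y *m T = T *m lmx y ->
    rmx (x * y) *m T = T *m lmx (x * y).
  by move=> ex ey; rewrite rmxM lmxM -mulmxA ey mulmxA ex mulmxA.
have Pt i j : rmx (T i j) *m T = T *m lmx (T i j).
  apply/matrixP => k l; rewrite !mxE.
  transitivity (\sum_k0 \sum_c tens_coef (R_sign u p q e) k k0 i c *: (T c j * T k0 l)).
    apply: eq_bigr => k0 _; rewrite !mxE ract_t mulr_suml.
    by apply: eq_bigr => c _; rewrite scalerAl.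
  rewrite (R_row_sum u_neq0 pq pij e (fun k c => T c j * T k l)).
  rewrite exchange_sign //.
  rewrite -(R_col_sum u_neq0 pq pij e (fun k0 c => T k k0 * T i c)).
  apply: eq_bigr => k0 _; rewrite !mxE lact_t mulr_sumr.
  by apply: eq_bigr => c _; rewrite scalerAr.
elim/A_ind: f => //.
  by rewrite rmx1 lmx1 mul1mx mulmx1.
move=> d; set D := det_q q T => Dd dD.
have P0 : rmx 0 *m T = T *m lmx 0.
  by rewrite -(addNr 1) -scaleN1r; apply: PD; rewrite rmx1 lmx1 mul1mx mulmx1.
have P1 : rmx 1 *m T = T *m lmx 1 by rewrite rmx1 lmx1 mul1mx mulmx1.
have PDet : rmx D *m T = T *m lmx D.
  rewrite /D /det_q; elim/big_rec: _ => // s x _ Px; apply: PD => //.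
  by elim/big_rec: _ => // i y _ Py; apply: PM.
(* Inserting 1 = [lmx D *m lmx d] on the right lets the known case [PDet] turn [T *m lmx D] into
   [rmx D *m T], and [rmx d] cancels [rmx D]. *)
rewrite -[rmx d *m T]mulmx1 -lmx1 -Dd lmxM mulmxA -(mulmxA _ T) -PDet.
by rewrite !mulmxA -rmxM dD rmx1 mul1mx.
Qed.

Let partial_ract e i j f :
  \sum_k lop (L e j k) f * S (T k i) = \sum_k S (T j k) * rop (L e k i) f.
Proof.
pose Smx : 'M[A]_n := \matrix_(i, j) S (T i j).
have TS : T *m Smx = 1%:M.
  apply/matrixP => k l; rewrite [LHS]mxE [RHS]mxE -mul_t_antipode.
  by apply: eq_bigr => r _; rewrite [Smx _ _]mxE.
have ST : Smx *m T = 1%:M.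
  apply/matrixP => k l; rewrite [LHS]mxE [RHS]mxE -mul_antipode_t.
  by apply: eq_bigr => r _; rewrite [Smx _ _]mxE.
have /(congr1 (fun X => Smx *m X *m Smx)) := conjugate_actions e f.
rewrite [in RHS]mulmxA ST mul1mx -!mulmxA TS mulmx1 => /matrixP/(_ j i).
rewrite !mxE => E.
transitivity (\sum_k (\matrix_(i, j) lop (L e i j) f) j k * Smx k i).
  by apply: eq_bigr => k _; rewrite !mxE.
by rewrite -E; apply: eq_bigr => k _; rewrite !mxE.
Qed.

Hypothesis u2_neqN1 : u ^+ 2 != -1.
Hypothesis LL : forall e e', (e, e') != (false, true) -> forall i a j b,
  R_diag u p true i a *: (L e i j * L e' a b)
  + R_off u true i a *: (L e a j * L e' i b) =
  R_diag u p true j b *: (L e' a b * L e i j)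
  + R_off u true b j *: (L e' a j * L e i b).

Local Notation B := (endo (oner_neq0 A)).
Local Notation hat f := (@pointwise K n A f).

Definition ract_endo (a : U) : B := EndoFun (ract_linear prP a).

Lemma ract_endo_linear : linear ract_endo.
Proof. by move=> c a b; apply: endo_ext => f /=; rewrite (ract_linearl prP). Qed.

HB.instance Definition _ := GRing.isLinear.Build K U B *:%R ract_endo ract_endo_linear.

Lemma ract_endoM a b : ract_endo (a * b) = ract_endo b * ract_endo a.
Proof. by apply: endo_ext => f /=; rewrite (ractM prP). Qed.

Lemma ract_endo_prod m (a : 'I_m -> U) :
  ract_endo (\prod_(k < m) a k) = \prod_(k < m) ract_endo (a (rev_ord k)).
Proof.
elim: m a => [|m IHm] a.
  by rewrite !big_ord0; apply: endo_ext => f /=; rewrite (ract1 prP).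
rewrite big_ord_recl ract_endoM IHm big_ord_recr /=; congr (_ * ract_endo (a _)).
  apply: eq_bigr => k _; congr (ract_endo (a _)); apply: val_inj.
  by rewrite /= /bump /= add1n subSS -subSn.
by apply: val_inj; rewrite /= subSS subnn.
Qed.

Let tB i j : B := lmul (T i j).
Let sB i j : B := lmul (S (T i j)).
Let MB e i j : B := ract_endo (L e i j).

Let tB_exchange : R_exchange u p tB tB.
Proof.
move=> i a j b; rewrite /tB -!lmulM -!linearZ -!linearD /=; congr lmul; exact: TT.
Qed.

Let MB_exchange e e' : (e, e') != (false, true) -> R_exchange u p (MB e) (MB e').
Proof.
move=> /LL ee i a j b.
by rewrite /MB -!ract_endoM -!linearZ -!linearD ee.
Qed.

Let MB_t e i j a b : MB e i j * tB a b =
  R_diag u p e i a *: (tB a b * MB e i j) + R_off u e i a *: (tB i b * MB e a j).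
Proof. by apply: endo_ext => f /=; rewrite ract_t_mul. Qed.

Let ts i j : \sum_k tB i k * sB k j = (i == j)%:R.
Proof.
under eq_bigr do rewrite /tB /sB -lmulM.
rewrite -linear_sum /= mul_t_antipode; case: (i == j) => /=; last exact: linear0.
by apply: endo_ext => f /=; rewrite mul1r.
Qed.

Let st i j : \sum_k sB i k * tB k j = (i == j)%:R.
Proof.
under eq_bigr do rewrite /tB /sB -lmulM.
rewrite -linear_sum /= mul_antipode_t; case: (i == j) => /=; last exact: linear0.
by apply: endo_ext => f /=; rewrite mul1r.
Qed.

Let hat_delta (i j : 'I_n) : hat (i == j)%:R = (i == j)%:R.
Proof. by case: (i == j); [exact: pointwise1 | exact: linear0]. Qed.

Let hat_exchange X X' : R_exchange u p X X' ->
  R_exchange u p (fun i j => hat (X i j)) (fun i j => hat (X' i j)).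
Proof.
by move=> XX i a j b; rewrite -!pointwiseM -!linearZ -!linearD XX.
Qed.

Let hat_ts i j : \sum_k hat (tB i k) * hat (sB k j) = (i == j)%:R.
Proof.
under eq_bigr do rewrite -pointwiseM.
by rewrite -linear_sum /= ts hat_delta.
Qed.

Let hat_st i j : \sum_k hat (sB i k) * hat (tB k j) = (i == j)%:R.
Proof.
under eq_bigr do rewrite -pointwiseM.
by rewrite -linear_sum /= st hat_delta.
Qed.

Let hat_Mt e i j a b : hat (MB e i j) * hat (tB a b) =
  R_diag u p e i a *: (hat (tB a b) * hat (MB e i j))
  + R_off u e i a *: (hat (tB i b) * hat (MB e a j)).
Proof. by rewrite -!pointwiseM MB_t linearD !linearZ. Qed.

Let hat_minor z f : hat (capelli_minor u p MB z f) =
  capelli_minor u p (fun e i j => hat (MB e i j)) z f.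
Proof.
rewrite linear_sum; apply: eq_bigr => r _; rewrite linearZ /= pointwise_prod; congr (_ *: _).
by apply: eq_bigr => k _; rewrite linearB !linearZ.
Qed.

Let hat_inverse : hat (inverse_det p sB) = inverse_det p (fun i j => hat (sB i j)).
Proof.
rewrite linear_sum; apply: eq_bigr => r _; rewrite linearZ /= pointwise_prod; congr (_ *: _).
Qed.

Let hat_quasi : hat (quasi_det p tB) = quasi_det p (fun i j => hat (tB i j)).
Proof.
rewrite linear_sum; apply: eq_bigr => r _; rewrite linearZ /= pointwise_prod; congr (_ *: _).
Qed.

Let hat_rdet z : hat (partial_rdet p sB MB z) =
  partial_rdet p (fun i j => hat (sB i j)) (fun e i j => hat (MB e i j)) z.
Proof.
rewrite linear_sum; apply: eq_bigr => r _; rewrite linearZ /= pointwise_prod; congr (_ *: _).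
apply: eq_bigr => k _; rewrite linear_sum; apply: eq_bigr => l _.
by rewrite /= pointwiseM linearB !linearZ.
Qed.

Let pVV i j : map_mx GRing.inv p i j * map_mx GRing.inv p j i = 1.
Proof. by rewrite !mxE -invfM mulrC pij invr1. Qed.

Let quasi_det_inv : quasi_det p tB * inverse_det p sB = 1.
Proof.
apply: (wedge_top_inj (w := p)).
rewrite pointwise1 mulr1 pointwiseM hat_quasi hat_inverse; apply/esym.
apply: (quasi_det_mul_inverse u_neq0 u2_neqN1 pij) => //.
- exact: wedge_grassmann.
- by move=> *; exact: wedge_pointwise.
- by move=> *; exact: wedge_pointwise.
- exact: hat_exchange.
Qed.

Let minor_perm z (r : 'S_n) : z != 0 ->
  capelli_minor u p MB z r = perm_weight p r *: capelli_minor u p MB z id.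
Proof.
move=> z0; apply: (wedge_top_inj (w := p)); rewrite linearZ /= -scalerAr !hat_minor.
apply: (capelli_minor_perm u_neq0 u2_neqN1 pij) => //.
- exact: wedge_grassmann.
- by move=> *; exact: wedge_pointwise.
- by move=> e; apply: hat_exchange; apply: MB_exchange; case: e.
- by apply: hat_exchange; apply: MB_exchange.
Qed.

Let rdet_minor z : partial_rdet p sB MB z =
  (\prod_(i < n) \prod_(j < n | (i < j)%N) (p i j)^-1) *:
    (inverse_det p sB * capelli_minor u p MB (z * u ^+ n.-1) id).
Proof.
(* Here the variables are the xi's, with relations for 1/p, matching the weights of the row
   determinant. *)
apply: (wedge_top_inj (w := map_mx GRing.inv p)).
rewrite linearZ /= -scalerAr pointwiseM hat_rdet hat_minor hat_inverse.
apply: (partial_rdetE u_neq0 u2_neqN1 pij (t := fun i j => hat (tB i j))).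
- exact: wedge_grassmann.
- by move=> *; exact: wedge_pointwise.
- by move=> *; exact: wedge_pointwise.
- by move=> *; exact: wedge_pointwise.
- exact: hat_ts.
- exact: hat_st.
- exact: hat_exchange.
- exact: hat_Mt.
Qed.

Local Notation Lspec z i j := (z *: L true i j - z^-1 *: L false i j).

Let c_sum (X : K) : U := \sum_(s : 'S_n) \sum_(r : 'S_n)
  (perm_weight p s * perm_weight q r) *:
    \prod_(k < n) Lspec (X / u ^+ rev_ord k) (s (rev_ord k)) (r (rev_ord k)).

(** Each inversion contributes (-p)(-q) = u^2, which is why the factorial is taken at u^2. The
    weight of q comes from c, that of p from permuting the columns of the minor. *)
Let weight_pq (r : 'S_n) : perm_weight p r * perm_weight q r =
  \prod_(i < n) \prod_(j < n | (i < j)%N) (if (r j < r i)%N then u ^+ 2 else 1).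
Proof.
rewrite !perm_weightE -big_split; apply: eq_bigr => i _ /=.
rewrite -big_split; apply: eq_bigr => j _ /=; rewrite /inv_weight.
by case: ifP => ji; rewrite ?mulr1 // mulrNN pq.
Qed.

Let ract_c_sum X : X != 0 ->
  ract_endo (c_sum X) = qfactorial (u ^+ 2) n *: capelli_minor u p MB X id.
Proof.
move=> X0; rewrite /c_sum exchange_big linear_sum -sum_inversions scaler_suml.
apply: eq_bigr => r _; rewrite -weight_pq mulrC -scalerA -minor_perm //.
rewrite linear_sum scaler_sumr; apply: eq_bigr => s _.
rewrite linearZ /= ract_endo_prod scalerA [_ * perm_weight p s]mulrC; congr (_ *: _).
(* The decreasing order of the factors in c is undone by the reversal of products in
   [ract_endo_prod]. *)
apply: eq_bigr => k _; have -> : (n - (rev_ord k).+1)%N = k := congr1 val (rev_ordK k).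
by rewrite rev_ordK linearB !linearZ.
Qed.

Let part (z : K) (i j : 'I_n) (f : A) : A :=
  (u - u^-1)^-1 *: \sum_(k < n) lop (Lspec z j k) f * S (T k i).

Let partE z i j f : part z i j f =
  (u - u^-1)^-1 *: (\sum_l sB j l * (z *: MB true l i - z^-1 *: MB false l i)) f.
Proof.
have lopE k : lop (Lspec z j k) f = z *: lop (L true j k) f - z^-1 *: lop (L false j k) f.
  by rewrite -!scaleNr (lact_linearl prP) (scalable_linear (lact_linearl prP f)).
congr (_ *: _); rewrite endo_sumE.
transitivity (z *: (\sum_k lop (L true j k) f * S (T k i))
    - z^-1 *: (\sum_k lop (L false j k) f * S (T k i))).
  rewrite !scaler_sumr -sumrB; apply: eq_bigr => k _.
  by rewrite lopE mulrBl -!scalerAl.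
rewrite !partial_ract !scaler_sumr -sumrB; apply: eq_bigr => k _.
by rewrite /= !scalerAr -mulrBr.
Qed.

Let prod_part z m (h : 'I_m -> 'I_n) (g : 'I_m -> 'I_n) f :
  (\big[(fun D E => D \o E)/id]_(k < m) part z (h k) (g k)) f =
  (u - u^-1) ^- m *:
    (\prod_(k < m) \sum_l sB (g k) l * (z *: MB true l (h k) - z^-1 *: MB false l (h k))) f.
Proof.
elim: m h g => [|m IHm] h g; first by rewrite !big_ord0 expr0 invr1 scale1r.
rewrite !big_ord_recl /= IHm partE (scalable_linear (endo_linear _)) scalerA.
by rewrite exprS invfM.
Qed.

Lemma capelli_identity x f : x != 0 -> qfactorial (u ^+ 2) n != 0 ->
  ((u - u^-1) ^- n * (qfactorial (u ^+ 2) n)^-1) *: rop (c_sum (x * u ^+ n.-1)) f =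
  (\prod_(i < n) \prod_(j < n | (i < j)%N) p i j) *:
    (det_p p T * \sum_(s : 'S_n) perm_weight (map_mx GRing.inv p) s *:
      (\big[(fun D E => D \o E)/id]_(k < n) part x k (s k)) f).
Proof.
move=> x0 qf0; set X := x * _; have X0 : X != 0 by rewrite mulf_neq0 ?expf_neq0.
rewrite -[rop _ f]/(ract_endo (c_sum X) f) ract_c_sum // endo_scaleE scalerA mulfVK //.
have -> : \sum_(s : 'S_n) perm_weight (map_mx GRing.inv p) s *:
      (\big[(fun D E => D \o E)/id]_(k < n) part x k (s k)) f =
    (u - u^-1) ^- n *: (partial_rdet p sB MB x : B) f.
  rewrite /partial_rdet endo_sumE scaler_sumr; apply: eq_bigr => s _.
  by rewrite (prod_part x id s) scalerA mulrC -scalerA.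
rewrite -scalerAr scalerA [_ * (_ ^- n)]mulrC -scalerA; congr (_ *: _).
have qE : quasi_det p tB = lmul (det_p p T).
  rewrite /det_p linear_sum; apply: eq_bigr => r _; rewrite linearZ; congr (_ *: _).
  by apply: endo_ext => g; rewrite prod_lmul.
transitivity ((\prod_(i < n) \prod_(j < n | (i < j)%N) p i j) *:
    (quasi_det p tB * partial_rdet p sB MB x) f); last first.
  by rewrite endo_mulE qE.
rewrite rdet_minor -scalerAr mulrA quasi_det_inv mul1r endo_scaleE scalerA.
rewrite -big_split /= big1 ?scale1r // => i _; rewrite -big_split /= big1 // => j _.
by rewrite divff ?skew_neq0.
Qed.

End QuantumGroupActions.

(** * Exchange relations in the presented algebras *)

Section ConcreteRelations.
Variables (K : fieldType) (n : nat) (u : K) (p q : 'M[K]_n).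
Hypothesis u_neq0 : u != 0.
Hypothesis pq : forall i j : 'I_n, (i < j)%N -> p i j * q i j = u ^+ 2.
Hypothesis pij : forall i j : 'I_n, p i j * p j i = 1.

Local Notation A := (GL_alg u p q).
Local Notation T := (GL_t u p q).
Local Notation U := (U_alg u p q).

Definition U_L (e : bool) : 'M[U]_n := if e then U_Lplus u p q else U_Lminus u p q.

Lemma GL_exchange : R_exchange u p T T.
Proof.
apply: (qmatrix_exchange u_neq0 pq pij) => x xR.
have tE i j : T i j = quot_proj (@GL_proper K n u p q) (GL_free_t K n i j) by rewrite mxE.
case: xR => [i k l kl|i j k ij|i j k l ij kl|i j k l ij kl]; rewrite !tE.
- rewrite -!rmorphM -linearZ -rmorphB; apply/quot_proj_eq0/Ideal_gen/GL_qmatrix.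
  exact: Qmatrix_row.
- rewrite -!rmorphM -linearZ -rmorphB; apply/quot_proj_eq0/Ideal_gen/GL_qmatrix.
  exact: Qmatrix_col.
- rewrite -!rmorphM -!linearZ -rmorphB; apply/quot_proj_eq0/Ideal_gen/GL_qmatrix.
  exact: Qmatrix_anti.
rewrite -!rmorphM -!linearZ -!rmorphB; apply/quot_proj_eq0/Ideal_gen/GL_qmatrix.
exact: Qmatrix_diag.
Qed.

Lemma U_exchange e e' : (e, e') != (false, true) -> forall i a j b,
  R_diag u p true i a *: (U_L e i j * U_L e' a b)
  + R_off u true i a *: (U_L e a j * U_L e' i b) =
  R_diag u p true j b *: (U_L e' a b * U_L e i j)
  + R_off u true b j *: (U_L e' a j * U_L e i b).
Proof.
move=> ee; apply: (RLL_exchange u_neq0 pq pij) => x y.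
have LE s : U_L s = map_mx (quot_proj (@U_proper K n u p q)) (U_free_L K n s) by case: s.
rewrite !LE -map_RLL mxE; apply/quot_proj_eq0/Ideal_gen.
case: e e' ee => [] [] // _; [exact: U_plus_plus|exact: U_plus_minus|exact: U_minus_minus].
Qed.

End ConcreteRelations.

Theorem theorem4p6 (R : realType) (n : nat) (u : R[i]) (p q : 'M[R[i]]_n)
  (n_gt0 : (0 < n)%N)
  (u_neq0 : u != 0)
  (pq : forall i j : 'I_n, (i < j)%N -> p i j * q i j = u ^+ 2)
  (pii : forall i : 'I_n, p i i = 1)
  (qii : forall i : 'I_n, q i i = 1)
  (pij : forall i j : 'I_n, p i j * p j i = 1)
  (qij : forall i j : 'I_n, q i j * q j i = 1)
  (u2_neqN1 : u ^+ 2 != -1)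
  (u2_neq1 : u ^+ 2 != 1)
  (fact_neq0 : qfactorial (u ^+ 2) n != 0)
  (HG : hopf_algebra (GL_alg u p q))
  (comul_t : forall i j, comul HG (GL_t u p q i j) =
     \sum_(k < n) pure_tensor (GL_t u p q i k) (GL_t u p q k j))
  (counit_t : forall i j, counit HG (GL_t u p q i j) = (i == j)%:R)
  (HU : hopf_algebra (U_alg u p q))
  (comul_Lplus : forall i j, comul HU (U_Lplus u p q i j) =
     \sum_(k < n) pure_tensor (U_Lplus u p q i k) (U_Lplus u p q k j))
  (comul_Lminus : forall i j, comul HU (U_Lminus u p q i j) =
     \sum_(k < n) pure_tensor (U_Lminus u p q i k) (U_Lminus u p q k j))
  (counit_Lplus : forall i j, counit HU (U_Lplus u p q i j) = (i == j)%:R)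
  (counit_Lminus : forall i j, counit HU (U_Lminus u p q i j) = (i == j)%:R)
  (pr : U_alg u p q -> GL_alg u p q -> R[i])
  (pr_hopf : hopf_pairing HU HG pr)
  (pr_Lplus : forall i j a b, pr (U_Lplus u p q i j) (GL_t u p q a b) =
     tens_coef (R_plus u p q) i j a b)
  (pr_Lminus : forall i j a b, pr (U_Lminus u p q i j) (GL_t u p q a b) =
     tens_coef (R_minus u p q) i j a b)
  (x : R[i]) (x_neq0 : x != 0) :
  forall f : GL_alg u p q,
    d_op HG pr (x * u ^+ n.-1) f =
    (\prod_(i < n) \prod_(j < n | (i < j)%N) p i j) *:
      (det_p p (GL_t u p q) * rdet_partial HG pr x f).
Proof.
move=> f.
have comul_L e i j : comul HU (U_L u p q e i j) =
    \sum_k pure_tensor (U_L u p q e i k) (U_L u p q e k j).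
  by case: e; [exact: comul_Lplus | exact: comul_Lminus].
have counit_L e i j : counit HU (U_L u p q e i j) = (i == j)%:R.
  by case: e; [exact: counit_Lplus | exact: counit_Lminus].
have pr_L e i j a b :
    pr (U_L u p q e i j) (GL_t u p q a b) = tens_coef (R_sign u p q e) i j a b.
  by case: e; [exact: pr_Lplus | exact: pr_Lminus].
have main := capelli_identity u_neq0 pq pij (@GL_alg_ind _ _ _ _ _)
  (GL_exchange u_neq0 pq pij) comul_t counit_t comul_L counit_L pr_hopf pr_L
  u2_neqN1 (@U_exchange _ _ _ _ _ u_neq0 pq pij) f x_neq0 fact_neq0.
rewrite /d_op /rdet_partial.
have -> : c_elt u p q (x * u ^+ n.-1) =
    \sum_(s : 'S_n) \sum_(r : 'S_n) (perm_weight p s * perm_weight q r) *: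
      \prod_(k < n) (x * u ^+ n.-1 / u ^+ rev_ord k *:
         U_L u p q true (s (rev_ord k)) (r (rev_ord k)) -
       (x * u ^+ n.-1 / u ^+ rev_ord k)^-1 *:
         U_L u p q false (s (rev_ord k)) (r (rev_ord k))).
  apply: eq_bigr => s _; apply: eq_bigr => r _; congr (_ *: _).
  by apply: eq_bigr => k _; rewrite mxE.
refine (etrans main (congr1 (fun y => _ *: (det_p p (GL_t u p q) * y)) _)).
apply: eq_bigr => s _; apply: (congr1 (fun h => _ *: h f)).
apply: eq_bigr => k _; apply: boolp.funext => g; apply: (congr1 (fun y => _ *: y)).
apply: eq_bigr => l _; apply: (congr1 (fun a => lact HG pr a g * _)).
by rewrite [RHS]mxE.
Qed.
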